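(* Let $V=[n]$ and let $\boldsymbol{d}^+=(d_v^+)_{v\in V}$, $\boldsymbol{d}^-=(d_v^-)_{v\in V}$ be sequences of nonnegative integers and $\sigma:\mathbb{Z}_+^2\to\mathbb{N}$ a function (all depending on $n$) such that $$M^+ :=\sum_{v \in V} d_v^+ = \sum_{(a^+,a^-)\in\mathbb{Z}_+^2} a^+\, \sigma(a^+,a^-), \qquad M^- :=\sum_{v \in V} d_v^- = \sum_{(a^+,a^-)\in\mathbb{Z}_+^2} a^-\, \sigma(a^+,a^-),$$ and suppose that $\kappa := \min\{a^++a^- : (a^+,a^-)\in\mathbb{Z}_+^2,\ \sigma(a^+,a^-)>0\}\ge 3$. Let $m=\sum_{(a^+,a^-)}\sigma(a^+,a^-)$, and let $\vec{H}(\boldsymbol{d}^+,\boldsymbol{d}^-,\sigma)$ be the number of directed hypergraphs on vertex set $V$ with out-degree sequence $\boldsymbol{d}^+$, in-degree sequence $\boldsymbol{d}^-$, and with exactly $\sigma(a^+,a^-)$ hyperarcs $e$ satisfying $|e^+|=a^+$, $|e^-|=a^-$ for every $(a^+,a^-)\in\mathbb{Z}_+^2$. (a) [B-hypergraphs] Suppose that $\sigma(a^+,a^-)=0$ whenever $a^-\neq 1$. If $\Delta^4=o(M^+)$ then $$\vec{H}(\boldsymbol{d}^+,\boldsymbol{d}^-,\sigma) = \frac{M^+!\, m!}{\prod_{v\in V} d_v^+!\, d_v^-!\, \prod_{e\in E} k_e^+!\, \prod_{a^+\in\mathbb{Z}_+} \sigma(a^+,1)!}\,\exp\left( F(\boldsymbol{d}^+,\boldsymbol{k}^+)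 - \frac{R(\boldsymbol{d})}{m} + O\left(\frac{\Delta^4}{M^+}\right)\right).$$ (b) [F-hypergraphs] Suppose that $\sigma(a^+,a^-)=0$ whenever $a^+\neq 1$. If $\Delta^4=o(M^-)$ then $$\vec{H}(\boldsymbol{d}^+,\boldsymbol{d}^-,\sigma) = \frac{M^-!\, m!}{\prod_{v\in V} d_v^+!\, d_v^-!\, \prod_{e\in E} k_e^-!\, \prod_{a^-\in\mathbb{Z}_+} \sigma(1,a^-)!}\,\exp\left( F(\boldsymbol{d}^-,\boldsymbol{k}^-) - \frac{R(\boldsymbol{d})}{m} + O\left(\frac{\Delta^4}{M^-}\right)\right).$$
   Context: $\mathbb{N}=\{0,1,2,\ldots\}$, $\mathbb{Z}_+=\{1,2,\ldots\}$. A hyperarc on a finite set $V$ is an ordered pair $e=(e^+,e^-)$ of nonempty disjoint subsets of $V$ ($e^+$ is the tail, $e^-$ the head). A directed hypergraph $H=(V,E)$ consists of a finite vertex set $V$ and a set $E$ of hyperarcs (so no repeated hyperarcs). The out-degree of $v$ is $d_v^+=|\{e\in E: v\in e^+\}|$ and its in-degree is $d_v^-=|\{e\in E: v\in e^-\}|$. Given $\sigma$, let $(k_1^+,k_1^-),\ldots,(k_m^+,k_m^-)$ be the list containing exactly $\sigma(a^+,a^-)$ copies of $(a^+,a^-)$ for each $(a^+,a^-)\in\mathbb{Z}_+^2$, arranged in reverse lexicographic order. Put $\boldsymbol{k}^+=(k_1^+,\ldots,k_m^+)$, $\boldsymbol{k}^-=(k_1^-,\ldots,k_m^-)$; the index set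 of this list is denoted $E$ (of size $m$), and one writes $k_e^\pm$ for $e\in E$. Write $\boldsymbol{d}=(\boldsymbol{d}^+,\boldsymbol{d}^-)$. Let $d_{\max}^{\pm}=\max_{v\in V} d_v^{\pm}$, $k_{\max}^{\pm}=\max_{e\in E}k_e^{\pm}$, $\Delta=\max\{d_{\max}^+,d_{\max}^-,k_{\max}^+,k_{\max}^-\}$, and $R(\boldsymbol{d})=\sum_{v\in V} d_v^+d_v^-$. For nonnegative integer vectors $\boldsymbol{s}=(s_1,\ldots,s_p)$, $\boldsymbol{t}=(t_1,\ldots,t_q)$ both with sum $S$, let $S_r=\sum_{i}(s_i)_r$ and $T_r=\sum_j (t_j)_r$ for $r=2,3$, where $(a)_b=a(a-1)\cdots(a-b+1)$, and define $$F(\boldsymbol{s},\boldsymbol{t})= - \frac{S_2T_2}{2S^2} - \frac{S_2T_2}{2S^3} + \frac{S_3T_3}{3S^3} - \frac{S_2T_2(S_2+T_2)}{4S^4} - \frac{S_2^{2}T_3 + S_3 T_2^{2}}{2S^4} + \frac{S_2^{2}T_2^{2}}{2S^5}.$$ Asymptotics are as $n\to\infty$; $M^+=M^+(n)$ and $M^-=M^-(n)$ are assumed to be positive integers which both tend to infinity. Convention on asymptotic notation: a statement ''if $\varepsilon_n=o(1)$ then [formula with error term $O(g_n)$]'' means that there exist positive absolute constants $\varepsilon$, $C$ such that if $\varepsilon_n<\varepsilon$ then the absolute value of the error term is at most $C g_n$. *)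

(* Defs.v *)
From mathcomp Require Import all_boot all_order all_algebra.
From mathcomp Require Import finmap.
From mathcomp Require Import boolp reals.

Set Implicit Arguments.
Unset Strict Implicit.
Unset Printing Implicit Defensive.

Import Order.TTheory GRing.Theory Num.Theory.

Local Open Scope ring_scope.

Notation posnat := {k : nat | (0 < k)%N}.

(* Functions Z_+^2 -> N. Finite support is no restriction here, since the sums *)
(* over Z_+^2 in which sigma occurs are required to be natural numbers.        *)
Notation typefun := {fsfun posnat * posnat -> nat with 0%N}.

Section Hypergraphs.
Variable n : nat.


Definition tail (e : {set 'I_n} * {set 'I_n}) : {set 'I_n} := e.1.
Definition head (e : {set 'I_n} * {set 'I_n}) : {set 'I_n} := e.2.

Definition hyperarc (e : {set 'I_n} * {set 'I_n}) : bool :=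
  [&& tail e != set0, head e != set0 & [disjoint tail e & head e]].

Definition directed_hypergraph (E : {set {set 'I_n} * {set 'I_n}}) : Prop :=
  forall e, e \in E -> hyperarc e.

Definition outdeg (E : {set {set 'I_n} * {set 'I_n}}) (v : 'I_n) : nat :=
  #|[set e in E | v \in tail e]|.

Definition indeg (E : {set {set 'I_n} * {set 'I_n}}) (v : 'I_n) : nat :=
  #|[set e in E | v \in head e]|.

Definition realizes (dp dm : n.-tuple nat) (sigma : typefun)
    (E : {set {set 'I_n} * {set 'I_n}}) : Prop :=
  [/\ directed_hypergraph E,
      forall v, outdeg E v = tnth dp v,
      forall v, indeg E v = tnth dm v &
      forall a : posnat * posnat,
        #|[set e in E | (#|tail e| == val a.1) && (#|head e| == val a.2)]|
        = sigma a].

Definition num_dirhyp (dp dm : n.-tuple nat) (sigma : typefun) : nat :=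
  #|[set E : {set {set 'I_n} * {set 'I_n}} | `[< realizes dp dm sigma E >]]|.

End Hypergraphs.

Definition revlex : rel (nat * nat) :=
  [rel a b | (b.1 < a.1)%N || (b.1 == a.1) && (b.2 <= a.2)%N].

Definition klist (sigma : typefun) : seq (nat * nat) :=
  sort revlex
    (flatten [seq nseq (sigma a) (val a.1, val a.2) | a <- finsupp sigma]).

Definition kplus (sigma : typefun) : seq nat := unzip1 (klist sigma).
Definition kminus (sigma : typefun) : seq nat := unzip2 (klist sigma).

Definition num_arcs (sigma : typefun) : nat :=
  (\sum_(a <- finsupp sigma) sigma a)%N.

Definition sum_seq (s : seq nat) : nat := (\sum_(x <- s) x)%N.
Definition max_seq (s : seq nat) : nat := (\max_(x <- s) x)%N.

(* Minimum of a nonempty sequence (0 on the empty one). *)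
Definition min_seq (s : seq nat) : nat := \big[minn/seq.head 0 s]_(x <- s) x.

Definition kappa (sigma : typefun) : nat :=
  min_seq [seq (val a.1 + val a.2)%N | a <- finsupp sigma].

Definition setting n (dp dm : n.-tuple nat) (sigma : typefun) : Prop :=
  [/\ sum_seq dp = (\sum_(a <- finsupp sigma) val a.1 * sigma a)%N,
      sum_seq dm = (\sum_(a <- finsupp sigma) val a.2 * sigma a)%N,
      (0 < sum_seq dp)%N,
      (0 < sum_seq dm)%N &
      (3 <= kappa sigma)%N].

Definition Delta n (dp dm : n.-tuple nat) (sigma : typefun) : nat :=
  maxn (maxn (max_seq dp) (max_seq dm))
       (maxn (max_seq (kplus sigma)) (max_seq (kminus sigma))).

Definition Rd n (dp dm : n.-tuple nat) : nat :=
  (\sum_(v < n) tnth dp v * tnth dm v)%N.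

Definition ffact_sum (s : seq nat) (r : nat) : nat := (\sum_(x <- s) x ^_ r)%N.

(* Used only for s and t with the same sum. *)
Definition F (R : numFieldType) (s t : seq nat) : R :=
  let S : R := (sum_seq s)%:R in
  let S2 : R := (ffact_sum s 2)%:R in
  let S3 : R := (ffact_sum s 3)%:R in
  let T2 : R := (ffact_sum t 2)%:R in
  let T3 : R := (ffact_sum t 3)%:R in
  - (S2 * T2 / (2 * S ^+ 2)) - S2 * T2 / (2 * S ^+ 3)
  + S3 * T3 / (3 * S ^+ 3)
  - S2 * T2 * (S2 + T2) / (4 * S ^+ 4)
  - (S2 ^+ 2 * T3 + S3 * T2 ^+ 2) / (2 * S ^+ 4)
  + S2 ^+ 2 * T2 ^+ 2 / (2 * S ^+ 5).

(* Main.v *)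
Require Import Defs.
From mathcomp Require Import all_boot all_order all_fingroup all_algebra.
From mathcomp Require Import finmap.
From mathcomp Require Import boolp reals sequences exp.
From mathcomp Require Import zify ring lra.

(** The exponent is determined only up to [O(Delta^4 / M)], and at that precision
    [F] reduces to its leading term [- S2 T2 / (2 S^2)] ([F_approx]).  What has to
    be shown is therefore that the number of hypergraphs is the stated quotient of
    factorials times [exp (- S2 T2 / (2 M^2) - R / m + O (Delta^4 / M))].

    Take case (a), where heads are single vertices, and label the hyperarcs by
    [1..m].  Give vertex [v] a set of [d_v^+] out-points and [d_v^-] in-points, and
    hyperarc [e] a set of [k_e] tail points.  A bijection [pi] from the [M]
    out-points to the [M] tail points, together with a bijection [rho] from the
    hyperarcs to the [m] in-points, describes tails and heads.  Every labelled
    hypergraph comes from exactly [prod d_v^+! d_v^-! * prod k_e!] such pairs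
    ([card_simple], [card_assignments]), and a pair describes a hypergraph when
    - no two points of a vertex are matched into the same hyperarc;
    - no head lies in its own tail;
    - no two hyperarcs coincide.
    The first condition forbids [S2 T2 / 2] pairs of cells of the permutation
    matrix of [pi], each of probability about [1 / M^2].  Given such a [pi], the
    second forbids cells of the matrix of [rho], each of probability [1 / m], and
    their number is [R] whatever [pi] is ([card_loops]); so the two counts simply
    multiply.  The third condition changes the count by a relative
    [O (Delta^4 / M)]: two coinciding hyperarcs share a head and, because
    [kappa >= 3], at least two tail vertices.

    Both counts are instances of one estimate for permutations of a set of size
    [M] (or [m]) that avoid a list of [N] forbidden configurations, each of
    probability [q].  Forbid them one
    after the other.  If the probability of hitting the next one, given that the
    earlier ones are avoided, is [q (1 + O (D / M))], then the product of the [N]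
    complementary probabilities is [exp (- N q + O (N q D / M))]
    ([product_estimate]).  That conditional probability is computed by a
    switching: composing with the transposition that makes a permutation hit a
    prescribed cell creates a forbidden configuration only with probability
    [O (D / M)] ([upper_step], [lower_step]).  Since one event is treated at a
    time, the distribution of the number of forbidden configurations never has to
    be studied, although its mean may grow like [Delta^2].

    Case (b) is case (a) after reversing all hyperarcs ([arrangements_reverse]). *)

Set Implicit Arguments.
Unset Strict Implicit.
Unset Printing Implicit Defensive.

Import Order.TTheory GRing.Theory Num.Theory.

(** * Counting tools *)

Section CountingTools.

Lemma leq_card_bigcup (I S : finType) (A : pred I) (B : I -> {set S}) :
  #|\bigcup_(i | A i) B i| <= \sum_(i | A i) #|B i|.
Proof.
elim/big_rec2: _ => [|i y C _ IH]; first by rewrite cards0.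
by rewrite (leq_trans (leq_card_setU _ _)) // leq_add2l.
Qed.

Lemma card_bigcup_le (I S : finType) (A : {set I}) (B : I -> {set S}) (K L : nat) :
  (forall i, i \in A -> #|B i| * K <= L) ->
  #|\bigcup_(i in A) B i| * K <= #|A| * L.
Proof.
move=> h; rewrite -[X in _ <= X]sum_nat_const.
apply: (@leq_trans (\sum_(i in A) (#|B i| * K))); last exact: leq_sum.
by rewrite -big_distrl /= leq_mul2r leq_card_bigcup orbT.
Qed.

Lemma card_bigcup_const (I S : finType) (A : {set I}) (B : I -> {set S}) (L : nat) :
  (forall i, i \in A -> #|B i| <= L) -> #|\bigcup_(i in A) B i| <= #|A| * L.
Proof. by move=> h; rewrite -[X in X <= _]muln1; apply: card_bigcup_le => i /h;
  rewrite muln1. Qed.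

Lemma card_dep_pair (I S : finType) (A : pred I) (B : I -> pred S) :
  #|[set x : I * S | A x.1 && B x.1 x.2]| = \sum_(i | A i) #|B i|.
Proof.
rewrite -sum1_card; under eq_bigl do rewrite inE.
rewrite -(pair_big_dep A B (fun _ _ => 1)) /=.
by apply: eq_bigr => i _; rewrite sum1_card.
Qed.

Lemma setIdT (S : finType) (A : {set S}) : [set x in A | true] = A.
Proof. by apply/setP => x; rewrite in_set andbT. Qed.

Lemma eq_from_sum (I : finType) (a b : I -> nat) :
  (forall i, a i <= b i) -> \sum_i a i = \sum_i b i -> forall i, a i = b i.
Proof.
move=> le e i; apply/eqP; rewrite eqn_leq le /=.
have := leqif_sum (fun i (_ : xpredT i) => leqif_geq (le i)).
by move=> [_]; rewrite e eqxx => /esym/forallP/(_ i).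
Qed.

Lemma card_perm_preim (T : finType) (s : {perm T}) (A : {set T}) :
  #|[set a | s a \in A]| = #|A|.
Proof.
rewrite -(card_imset [set a | s a \in A] (@perm_inj _ s)); apply: eq_card => x.
apply/imsetP/idP => [[a + ->]|xA]; first by rewrite inE.
by exists ((s^-1)%g x); rewrite ?inE permKV.
Qed.

End CountingTools.

Section Lifts.

Lemma card_tnth (K : eqType) (N : nat) (t : N.-tuple K) (a : pred K) :
  #|[set i | a (tnth t i)]| = count a t.
Proof.
rewrite -sum1_card -sum1_count big_tuple.
by apply: eq_bigl => i; rewrite inE.
Qed.

(** Choose the entries one at a time: an entry of key [k] may be any element of
    the fibre of [k] not used before, hence the falling factorials. *)
Lemma card_lift_tuple (T : finType) (K : eqType) (f : T -> K) (ks : seq K) N (cs : N.-tuple K) :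
  uniq ks -> {subset cs <= ks} ->
  #|[set t : N.-tuple T | uniq t && (map f t == cs)]|
  = \prod_(k <- ks) #|[set x | f x == k]| ^_ (count_mem k cs).
Proof.
move=> uks; elim: N cs => [|N IH] cs sub.
  rewrite (tuple0 cs) big1 //= (_ : [set _ | _] = [set [tuple]]) ?cards1 //.
  by apply/setP => t; rewrite !inE (tuple0 t).
case/tupleP: cs sub => c cs sub.
have sub' : {subset cs <= ks} by move=> x xc; apply: sub; rewrite inE xc orbT.
have cks : c \in ks by apply: sub; rewrite inE eqxx.
pose S := [set t : N.-tuple T | uniq t && (map f t == cs)].
pose Q := [set x : N.-tuple T * T | (x.1 \in S) && ((x.2 \notin x.1) && (f x.2 == c))].
have -> : [set t : N.+1.-tuple T | uniq t && (map f t == cons_tuple c cs)]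
   = [set cons_tuple x.2 x.1 | x in Q].
  apply/setP => t; apply/idP/imsetP.
    case/tupleP: t => x t; rewrite inE /= eqseq_cons => /and3P[/andP[nx ut] fx ft].
    by exists (t, x) => //; rewrite !inE /= ut ft nx fx.
  move=> [[t' x] + ->]; rewrite !inE /= eqseq_cons => /andP[/andP[-> ->] /andP[-> ->]] //.
rewrite card_in_imset; last first.
  move=> [t x] [t' x'] _ _ /= /(congr1 val) /= [-> e]; congr pair; exact: val_inj.
rewrite (card_dep_pair (fun t => t \in S) (fun t x => (x \notin t) && (f x == c))).
under eq_bigr => t tS.
  have -> : #|(fun x => (x \notin t) && (f x == c))| = #|[set x | f x == c]| - count_mem c cs.
    rewrite -(cardsID [set x in t] [set x | f x == c]).
    have -> : #|[set x | f x == c] :&: [set x in t]| = count_mem c cs.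
      move: tS; rewrite inE => /andP[ut /eqP <-].
      rewrite count_map -size_filter -(card_uniqP _) ?filter_uniq //.
      by apply: eq_card => x; rewrite !inE mem_filter.
    rewrite addKn -cardsE; apply: eq_card => x; rewrite !inE.
    by rewrite unfold_in /=.
  over.
rewrite sum_nat_const -/S IH // (bigD1_seq c) //= [in RHS](bigD1_seq c) //= eqxx add1n ffactnSr.
rewrite mulnAC; congr (_ * _); apply: eq_bigr => k kc.
by rewrite eq_sym (negbTE kc).
Qed.

Lemma card_lifts (T : finType) (K : eqType) (f : T -> K) (ks : seq K) N (c : 'I_N -> K) :
  uniq ks -> (forall i, c i \in ks) ->
  #|[set h : {ffun 'I_N -> T} | injectiveb h && [forall i, f (h i) == c i]]|
  = \prod_(k <- ks) #|[set x | f x == k]| ^_ #|[set i | c i == k]|.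
Proof.
move=> uks sub; pose cs := [tuple c i | i < N].
have scs : {subset cs <= ks} by move=> x /mapP[i _ ->].
have cnt k : #|[set i | c i == k]| = count_mem k cs.
  by rewrite -card_tnth; apply: eq_card => i; rewrite !inE tnth_mktuple.
under eq_bigr do rewrite cnt.
rewrite -(card_lift_tuple f uks scs).
pose g (h : {ffun 'I_N -> T}) := [tuple h i | i < N].
have gI : injective g.
  by move=> h h' e; apply/ffunP => i; have := congr1 (fun t => tnth t i) e;
    rewrite !tnth_mktuple.
rewrite -(card_imset _ gI); apply: eq_card => t; rewrite inE; apply/imsetP/andP.
  move=> [h + ->]; rewrite inE => /andP[/injectiveP hI /forallP fh]; split.
    by rewrite map_inj_uniq ?enum_uniq.
  by rewrite -map_comp; apply/eqP/eq_map => i /=; exact/eqP.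
move=> [ut /eqP e]; exists [ffun i => tnth t i]; last first.
  by apply: eq_from_tnth => i; rewrite tnth_mktuple ffunE.
rewrite inE; apply/andP; split.
  by apply/injectiveP => i j; rewrite !ffunE => /(tuple_uniqP _ ut).
apply/forallP => i; rewrite ffunE.
have {}e : map_tuple f t = cs by apply: val_inj.
by have := congr1 (fun x => tnth x i) e; rewrite tnth_map tnth_mktuple => ->.
Qed.

Lemma card_perm_lifts (K : eqType) N (f c : 'I_N -> K) (ks : seq K) :
  uniq ks -> (forall i, c i \in ks) ->
  (forall k, k \in ks -> #|[set x | f x == k]| = #|[set i | c i == k]|) ->
  #|[set s : {perm 'I_N} | [forall i, f (s i) == c i]]|
  = \prod_(k <- ks) (#|[set i | c i == k]|)`!.
Proof.
move=> uks sub efc.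
transitivity (\prod_(k <- ks) #|[set x | f x == k]| ^_ #|[set i | c i == k]|); last first.
  by apply: eq_big_seq => k kks; rewrite efc // ffactnn.
rewrite -card_lifts //.
have gI : injective (fun s : {perm 'I_N} => [ffun i => s i]).
  by move=> s s' /ffunP e; apply/permP => i; have := e i; rewrite !ffunE.
rewrite -(card_imset _ gI); apply: eq_card => h; rewrite inE; apply/imsetP/andP.
  move=> [s + ->]; rewrite inE => /forallP fs; split.
    by apply/injectiveP => i j; rewrite !ffunE; exact: perm_inj.
  by apply/forallP => i; rewrite ffunE.
move=> [/injectiveP hI /forallP fh]; exists (perm hI).
  by rewrite inE; apply/forallP => i; rewrite permE.
by apply/ffunP => i; rewrite ffunE permE.
Qed.

(** Provides the points of the pairing model: [d v] of them at each [v]. *)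
Lemma exists_labelling (V : finType) (d : V -> nat) M :
  \sum_v d v = M -> exists u : 'I_M -> V, forall v, #|[set i | u i == v]| = d v.
Proof.
move=> eM; pose s := flatten [seq nseq (d v) v | v <- enum V].
have ss : size s == M.
  rewrite size_flatten /shape -map_comp sumnE big_map big_enum /= -eM.
  by apply/eqP/eq_bigr => v _ /=; rewrite size_nseq.
exists (tnth (Tuple ss)) => v; rewrite (card_tnth (Tuple ss) (pred1 v)) /= /s.
rewrite count_flatten -map_comp sumnE big_map big_enum /= (bigD1 v) //=.
rewrite count_nseq /= eqxx mul1n.
by rewrite big1 ?addn0 // => x xv; rewrite count_nseq /= (negbTE xv) mul0n.
Qed.

Lemma card_fibres (S X : finType) (A : {set S}) (B : {set X}) (phi : S -> X) (K : nat) :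
  (forall s, s \in A -> phi s \in B) ->
  (forall x, x \in B -> #|[set s in A | phi s == x]| = K) ->
  #|A| = #|B| * K.
Proof.
move=> AB fib; rewrite -sum_nat_const -sum1_card (partition_big phi (mem B)) //=.
apply: eq_bigr => x xB; rewrite -(fib x xB) -sum1_card.
by apply: eq_bigl => s; rewrite inE.
Qed.

Lemma sum_by_fibre (S X : finType) (phi : S -> X) (F : X -> nat) :
  \sum_s F (phi s) = \sum_x #|[set s | phi s == x]| * F x.
Proof.
rewrite (partition_big phi xpredT) //=; apply: eq_bigr => x _.
rewrite -sum_nat_const (eq_bigl (fun s => s \in [set s | phi s == x]));
  last by move=> s; rewrite inE.
by apply: eq_bigr => s; rewrite inE => /eqP ->.
Qed.

Lemma card_fibre_pairs (S X : finType) (phi : S -> X) :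
  #|[set x : S * S | (phi x.1 == phi x.2) && (x.1 != x.2)]|
  = \sum_x #|[set s | phi s == x]| ^_ 2.
Proof.
rewrite (card_dep_pair xpredT (fun p q => (phi p == phi q) && (p != q))).
transitivity (\sum_s (#|[set s' | phi s' == phi s]|).-1).
  apply: eq_bigr => s _; rewrite (cardsD1 s [set s' | phi s' == phi s]) !inE eqxx /=.
  rewrite -cardsE; apply: eq_card => s'; rewrite !inE unfold_in /= andbC.
  by rewrite [s == s']eq_sym [phi s == _]eq_sym.
rewrite (sum_by_fibre phi (fun x => (#|[set s' | phi s' == x]|).-1)).
by apply: eq_bigr => x _; rewrite ffactnS ffactn1.
Qed.

End Lifts.

(** * Permutations avoiding a sparse relation: switchings *)

Section Switching.
Variable T : finType.
Implicit Types (J : rel (T * T)) (s : {perm T}) (P : seq (T * T)) (c : T * T).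

(** A pair [(i, j) : T * T] is a cell of the permutation matrix of [s], hit when
    [s i = j].  The relation [J] forbids hitting two related cells; since the two
    cells may be equal, forbidden single cells are the case [J c c]. *)
Definition avoids J s := [forall i, forall i', ~~ J (i, s i) (i', s i')].

Definition avoiding J P : {set {perm T}} :=
  [set s | avoids J s && all (fun c => s c.1 == c.2) P].

(** These bounds are what makes a transposition harmless.  If [s] avoids [J] and
    hits [(i, j)], composing it with the transposition of [i] and [a] replaces the
    cells [(i, j)] and [(a, s a)] by [(i, s a)] and [(a, j)].  A forbidden pair
    arises when one of the new cells is related to an old one ([sparse_row],
    [sparse_col]), to the other new one ([sparse_swap]) or to itself
    ([sparse_diag_row], [sparse_diag_col]).  The bound [sparse_nbr] serves the
    inverse switching, where the cell that appears is prescribed. *)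
Record sparse J (D : nat) : Prop := Sparse {
  sparse_sym : symmetric J;
  sparse_nbr : forall c, #|[set c' | J c c']| <= D;
  sparse_row : forall s i, #|[set a | [exists i', J (i, s a) (i', s i')]]| <= D;
  sparse_col : forall s j, #|[set a | [exists i', J (a, j) (i', s i')]]| <= D;
  sparse_swap : forall s i j, #|[set a | J (i, s a) (a, j)]| <= D;
  sparse_diag_row : forall i, #|[set z | J (i, z) (i, z)]| <= D;
  sparse_diag_col : forall j, #|[set a | J (a, j) (a, j)]| <= D }.

Lemma avoidsP J s :
  reflect (forall i i', ~~ J (i, s i) (i', s i')) (avoids J s).
Proof. by apply: (iffP forallP) => h i; [apply/forallP | apply/forallP => i']. Qed.

Lemma swapE s i a x :
  (tperm i a * s)%g x = if x == i then s a else if x == a then s i else s x.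
Proof.
rewrite permM; case: tpermP => [->|->|/eqP/negbTE-> /eqP/negbTE-> //].
  by rewrite eqxx.
by rewrite eqxx; case: eqP => [->|].
Qed.

(** Forward switching.  Transposing [c.1] with any [a] is injective on pairs
    [(s, a)] with [s] hitting [c], because [a] is recovered as the place where
    the result takes the value [c.2].  All but [size P + 5 * D] choices of [a]
    lead to a permutation that still avoids [J] and hits [P]. *)
Lemma upper_step J D c P : sparse J D -> c.1 \notin unzip1 P ->
  #|avoiding J (c :: P)| * (#|T| - size P - 5 * D) <= #|avoiding J P|.
Proof.
case=> Jsym _ Jr Jc Js Jdr Jdc ciP; case: c ciP => i j /= iP.
pose W s := [set a | (tperm i a * s)%g \in avoiding J P].
have HW s : s \in avoiding J ((i, j) :: P) -> #|T| - size P - 5 * D <= #|W s|.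
  rewrite inE /= => /and3P[/avoidsP av /eqP sij /allP sP].
  pose B := [set a | a \in unzip1 P] :|:
    ([set a | [exists i', J (i, s a) (i', s i')]] :|:
    ([set a | [exists i', J (a, j) (i', s i')]] :|:
    ([set a | J (i, s a) (a, j)] :|:
    ([set a | J (i, s a) (i, s a)] :|: [set a | J (a, j) (a, j)])))).
  have sub : ~: W s \subset B.
    apply/subsetP => a; rewrite in_setC; apply: contraR.
    rewrite !in_setU !inE !negb_or => /and5P[aP h1 h2 h3 /andP[h4 h5]].
    move: h1 h2; rewrite !negb_exists => /forallP h1 /forallP h2.
    have [eai|nai] := eqVneq a i.
      rewrite eai tperm1 mul1g; apply/andP; split; first exact/avoidsP.
      exact/allP.
    have h3' : ~~ J (a, j) (i, s a) by rewrite Jsym.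
    have h1' x : ~~ J (x, s x) (i, s a) by rewrite Jsym.
    have h2' x : ~~ J (x, s x) (a, j) by rewrite Jsym.
    apply/andP; split; last first.
      apply/allP => -[p x] px /=; rewrite swapE.
      have pP : p \in unzip1 P by apply/mapP; exists (p, x).
      have -> : (p == i) = false by apply: contraNF iP => /eqP <-.
      have -> : (p == a) = false by apply: contraNF aP => /eqP <-.
      exact: (sP _ px).
    apply/avoidsP => x x'; rewrite !swapE sij.
    case: (eqVneq x i) => [xi|xi]; case: (eqVneq x' i) => [xi'|xi'];
    case: (eqVneq x a) => [xa|xa]; case: (eqVneq x' a) => [xa'|xa'];
    rewrite ?xi ?xi' ?xa ?xa' //.
  have cB : #|B| <= size P + 5 * D.
    have c0 : #|[set a | a \in unzip1 P]| <= size P.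
      by rewrite cardsE -(size_map fst P) (leq_trans (card_size _)).
    have c4 : #|[set a | J (i, s a) (i, s a)]| <= D.
      rewrite -(card_imset _ (@perm_inj _ s)).
      apply: leq_trans (Jdr i); apply: subset_leq_card.
      by apply/subsetP => _ /imsetP[a + ->]; rewrite !inE.
    have hB : #|B| <= size P + (D + (D + (D + (D + D)))).
      rewrite /B; do 5! (rewrite (leq_trans (leq_card_setU _ _)) // leq_add //).
    apply: leq_trans hB _; clear; rewrite leq_add2l. lia.
  have h := leq_trans (subset_leq_card sub) cB.
  rewrite -subnDA leq_subLR -(cardsC (W s)) addnC.
  by rewrite leq_add2r.
pose Q := [set x : {perm T} * T | (x.1 \in avoiding J ((i, j) :: P)) && (x.2 \in W x.1)].
apply: (@leq_trans #|Q|).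
  rewrite (card_dep_pair (fun s => s \in avoiding J ((i, j) :: P)) (fun s a => a \in W s)).
  rewrite -sum_nat_const; apply: leq_sum => s hs; exact: HW.
have inj : {in Q &, injective (fun x : {perm T} * T => (tperm i x.2 * x.1)%g)}.
  move=> [s a] [s' a'] /=; rewrite !inE /= =>
    /andP[/and3P[_ /eqP h _] _] /andP[/and3P[_ /eqP h' _] _] E.
  have ea : (tperm i a * s)%g a = j by rewrite permM tpermR.
  have ea' : (tperm i a' * s')%g a' = j by rewrite permM tpermR.
  have aa : a = a' by move: ea; rewrite E -ea' => /perm_inj.
  rewrite -aa in E *; congr pair; exact: mulgI E.
rewrite -(card_in_imset inj); apply: subset_leq_card.
by apply/subsetP => _ /imsetP[[s a] + ->]; rewrite inE /= => /andP[_]; rewrite inE.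
Qed.

(** Iterating the forward switching: prescribing [size Q] further cells has
    conditional probability at most [(2 / #|T|) ^ size Q]. *)
Lemma upper_mul J D P Q : sparse J D -> 2 * (5 * D + 8) <= #|T| ->
  size Q + size P <= 6 -> uniq (unzip1 (Q ++ P)) ->
  #|avoiding J (Q ++ P)| * #|T| ^ size Q <= 2 ^ size Q * #|avoiding J P|.
Proof.
move=> sJ hT; elim: Q => [|c Q IH] /=; first by rewrite !muln1 mul1n.
move=> hs /andP[cQ uQ]; have {IH}IH := IH (ltnW hs) uQ.
have := upper_step sJ cQ; rewrite size_cat => up.
have : #|avoiding J (c :: Q ++ P)| * #|T| <= 2 * #|avoiding J (Q ++ P)|.
  have hM : #|T| <= 2 * (#|T| - (size Q + size P) - 5 * D).
    move: #|T| hT hs => M hT hs; lia.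
  apply: leq_trans
    (_ : _ <= #|avoiding J (c :: Q ++ P)| * (2 * (#|T| - (size Q + size P) - 5 * D))) _.
    by rewrite leq_mul2l hM orbT.
  by rewrite mulnCA leq_mul2l up.
move=> h; rewrite !expnS mulnA.
apply: leq_trans (_ : _ <= 2 * (#|avoiding J (Q ++ P)| * #|T| ^ size Q)) _.
  by rewrite mulnA leq_mul2r h orbT.
by rewrite -mulnA leq_mul2l IH orbT.
Qed.

(** Inverse switching.  To make [s] hit [c = (i, j)], transpose [i] with the place
    [a] where [s] takes the value [j]; every result has at most [#|T|] sources.
    The switching fails only if [s] hits one, two or three cells in one of the
    five configurations [B1] to [B5] below, and [upper_mul] bounds the probability
    of each, by [D / #|T|] times 2, 4, 4, 8 and 4: hence the constant 22. *)
Lemma lower_step J D c P : sparse J D -> 2 * (5 * D + 8) <= #|T| ->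
  size P <= 1 -> c.1 \notin unzip1 P -> c.2 \notin unzip2 P ->
  ~~ J c c -> (forall c', c' \in P -> ~~ J c c') ->
  #|avoiding J P| * #|T| <= #|T| * #|T| * #|avoiding J (c :: P)| + 22 * D * #|avoiding J P|.
Proof.
move=> sJ hT szP; case: c => i j /= iP jP nJc nJP.
have [Jsym Jn _ _ _ Jdr _] := sJ.
set M := #|T| in hT *; set N := #|avoiding J P|.
have uP : uniq (unzip1 P) by case: (P) szP => [|x []].
pose a s : T := (s^-1)%g j.
pose f s : {perm T} := (tperm i (a s) * s)%g.
have sa s : s (a s) = j by rewrite permKV.
pose G := [set s in avoiding J P | f s \in avoiding J ((i, j) :: P)].
have cG : #|G| <= M * #|avoiding J ((i, j) :: P)|.
  have inj : {in G &, injective (fun s => (f s, a s))}.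
    move=> s s' _ _ [] + ea; rewrite /f ea; exact: mulgI.
  rewrite -(card_in_imset inj).
  apply: (@leq_trans #|setX (avoiding J ((i, j) :: P)) [set: T]|).
    apply: subset_leq_card; apply/subsetP => _ /imsetP[s + ->].
    by rewrite inE => /andP[_ h]; rewrite in_setX h inE.
  by rewrite cardsX cardsT mulnC.
have up Q : size Q <= 3 -> uniq (unzip1 (Q ++ P)) ->
    #|avoiding J (Q ++ P)| * M ^ size Q <= 2 ^ size Q * N.
  by move=> sQ uQ; apply: (upper_mul sJ hT) => //; lia.
(* Write [z = s i], so that the new cells are [(i, j)] and [(a, z)].
   [B1]: [(i, j)] is related to an old cell. *)
pose A1 := [set c' : T * T | J (i, j) c' & c'.1 \notin unzip1 P].
pose B1 := \bigcup_(c' in A1) avoiding J (c' :: P).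
(* [B2]: the two new cells are related to each other. *)
pose A2 := [set c' : T * T | J (i, j) c' & (c'.1 != i) && (c'.1 \notin unzip1 P)].
pose Bw (c' : T * T) := avoiding J [:: (c'.1, j), (i, c'.2) & P].
pose B2 := \bigcup_(c' in A2) Bw c'.
(* [B3]: the cell [(a, z)] is forbidden by itself. *)
pose A3 := [set c' : T * T | J c' c' & (c'.1 != i) && (c'.1 \notin unzip1 P)].
pose B3 := \bigcup_(c' in A3) Bw c'.
(* [B4]: [(a, z)] is related to an old cell outside [P]. *)
pose A4 := [set y : (T * T) * (T * T) | J y.1 y.2 &
   uniq (unzip1 [:: y.2, (y.1.1, j), (i, y.1.2) & P])].
pose B4 := \bigcup_(y in A4) avoiding J [:: y.2, (y.1.1, j), (i, y.1.2) & P].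
(* [B5]: [(a, z)] is related to a cell of [P]. *)
pose A5 := [set c' : T * T | has (fun c => J c c') P & (c'.1 != i) && (c'.1 \notin unzip1 P)].
pose B5 := \bigcup_(c' in A5) Bw c'.
have sub : avoiding J P :\: G \subset B1 :|: (B2 :|: (B3 :|: (B4 :|: B5))).
  apply/subsetP => s; rewrite in_setD inE => /andP[+ sY]; rewrite sY /= => nf.
  have := sY; rewrite inE => /andP[/avoidsP av /allP sP].
  have aP : a s \notin unzip1 P.
    apply: contra jP => /mapP[[p x] px /= ep]; apply/mapP; exists (p, x) => //=.
    by have /eqP /= <- := sP _ px; rewrite -ep sa.
  have fP : all (fun c => f s c.1 == c.2) ((i, j) :: P).
    rewrite /= permM tpermL sa eqxx /=; apply/allP => -[p x] px /=.
    have pP : p \in unzip1 P by apply/mapP; exists (p, x).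
    rewrite swapE.
    have -> : (p == i) = false by apply: contraNF iP => /eqP <-.
    have -> : (p == a s) = false by apply: contraNF aP => /eqP <-.
    exact: (sP _ px).
  have [ai|ai] := eqVneq (a s) i.
    exfalso; move/negP: nf; apply; rewrite inE fP andbT.
    by rewrite /f ai tperm1 mul1g; apply/avoidsP.
  have Bws : s \in Bw (a s, s i) by rewrite inE /= sa !eqxx; apply/andP; split;
    [apply/avoidsP|apply/allP].
  have inB1 x : J (i, j) (x, s x) -> x \notin unzip1 P -> s \in B1.
    move=> h xP; apply/bigcupP; exists (x, s x); first by rewrite inE h.
    by rewrite inE /= eqxx; apply/andP; split; [apply/avoidsP|apply/allP].
  have inP x : x \in unzip1 P -> (x, s x) \in P.
    by move=> /mapP[[p y] py /= ->]; have /eqP /= -> := sP _ py.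
  pose U := B1 :|: (B2 :|: (B3 :|: (B4 :|: B5))).
  have U1 : s \in B1 -> s \in U by rewrite !in_setU => ->.
  have U2 : s \in B2 -> s \in U by rewrite !in_setU => ->; rewrite !orbT.
  have U3 : s \in B3 -> s \in U by rewrite !in_setU => ->; rewrite !orbT.
  have U4 : s \in B4 -> s \in U by rewrite !in_setU => ->; rewrite !orbT.
  have U5 : s \in B5 -> s \in U by rewrite !in_setU => ->; rewrite !orbT.
  suff : s \in U by rewrite !inE.
  have key x x' : J (x, f s x) (x', f s x') -> (x == i) || (x == a s) ->
     s \in U.
    rewrite !swapE sa => h /orP[/eqP e|/eqP e]; move: h; rewrite e ?eqxx ?(negbTE ai).
    - case: (eqVneq x' i) => [->|xi']; first by rewrite (negbTE nJc).
      case: (eqVneq x' (a s)) => [->|xa'] h.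
        by apply: U2; apply/bigcupP; exists (a s, s i) => //; rewrite inE h ai.
      apply: U1; apply: (inB1 x') => //; apply/negP => /inP /nJP; by rewrite h.
    - case: (eqVneq x' i) => [->|xi'].
        rewrite Jsym => h.
        by apply: U2; apply/bigcupP; exists (a s, s i) => //; rewrite inE h ai.
      case: (eqVneq x' (a s)) => [->|xa'] h.
        by apply: U3; apply/bigcupP; exists (a s, s i) => //; rewrite inE h ai.
      have [xP|xP] := boolP (x' \in unzip1 P).
        apply: U5; apply/bigcupP; exists (a s, s i) => //; rewrite inE ai aP !andbT /=.
        by apply/hasP; exists (x', s x'); [exact: inP| rewrite Jsym].
      apply: U4; apply/bigcupP; exists ((a s, s i), (x', s x')).
        rewrite inE h /= !inE (negbTE xi') (negbTE xa') (negbTE xP).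
        by rewrite (negbTE ai) (negbTE aP) (negbTE iP).
      by rewrite inE /= sa !eqxx /=; apply/andP; split; [apply/avoidsP|apply/allP].
  case: (boolP (s \in U)) => // nB; move/negP: nf; case; rewrite inE fP andbT;
    apply/avoidsP => x x'; apply/negP => h.
  have [xi|xi] := boolP ((x == i) || (x == a s)); first by rewrite (key _ _ h xi) in nB.
  have [xi'|xi'] := boolP ((x' == i) || (x' == a s)).
    by move: h; rewrite Jsym => h; rewrite (key _ _ h xi') in nB.
  move: xi xi' h; rewrite !swapE !negb_or =>
    /andP[/negbTE -> /negbTE ->] /andP[/negbTE -> /negbTE ->].
  exact/negP.
have cBw c' : (c'.1 != i) && (c'.1 \notin unzip1 P) -> #|Bw c'| * M ^ 2 <= 4 * N.
  move=> /andP[ci cP]; apply: (up [:: (c'.1, j); (i, c'.2)]) => //=.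
  by rewrite inE negb_or ci cP iP.
have c1 : #|B1| * M <= D * (2 * N).
  apply: (@leq_trans (#|A1| * (2 * N))); last first.
    rewrite leq_mul2r; apply/orP; right; apply: leq_trans (Jn (i, j)).
    by apply: subset_leq_card; apply/subsetP => x; rewrite !inE => /andP[].
  apply: card_bigcup_le => c'; rewrite inE => /andP[_ cP].
  by have := up [:: c'] isT; rewrite /= cP expn1; apply.
have c2 : #|B2| * M ^ 2 <= D * (4 * N).
  apply: (@leq_trans (#|A2| * (4 * N))); last first.
    rewrite leq_mul2r; apply/orP; right; apply: leq_trans (Jn (i, j)).
    by apply: subset_leq_card; apply/subsetP => x; rewrite !inE => /andP[].
  by apply: card_bigcup_le => c'; rewrite inE => /andP[_ cP]; exact: cBw.
have c3 : #|B3| * M ^ 2 <= M * D * (4 * N).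
  apply: (@leq_trans (#|A3| * (4 * N))); last first.
    rewrite leq_mul2r; apply/orP; right.
    apply: (@leq_trans #|[set c' : T * T | J c' c']|).
      by apply: subset_leq_card; apply/subsetP => x; rewrite !inE => /andP[].
    rewrite (_ : [set c' : T * T | J c' c'] =
        [set c' : T * T | xpredT c'.1 && J (c'.1, c'.2) (c'.1, c'.2)]);
      last by apply/setP => -[p q]; rewrite !inE.
    rewrite (card_dep_pair xpredT (fun p q => J (p, q) (p, q))) /M -sum_nat_const;
      apply: leq_sum => p _.
    by apply: leq_trans (Jdr p); rewrite cardsE.
  by apply: card_bigcup_le => c'; rewrite inE => /andP[_ cP]; exact: cBw.
have c4 : #|B4| * M ^ 3 <= M * M * D * (8 * N).
  apply: (@leq_trans (#|A4| * (8 * N))); last first.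
    rewrite leq_mul2r; apply/orP; right.
    apply: (@leq_trans #|[set y : (T * T) * (T * T) | J y.1 y.2]|).
      by apply: subset_leq_card; apply/subsetP => x; rewrite !inE => /andP[].
    rewrite (card_dep_pair xpredT (fun p q => J p q)) /M -card_prod -sum_nat_const;
      apply: leq_sum => p _.
    by apply: leq_trans (Jn p); rewrite cardsE.
  apply: card_bigcup_le => y; rewrite inE => /andP[_ cP].
  by apply: (up [:: y.2; (y.1.1, j); (i, y.1.2)]).
have c5 : #|B5| * M ^ 2 <= D * (4 * N).
  apply: (@leq_trans (#|A5| * (4 * N))); last first.
    rewrite leq_mul2r; apply/orP; right.
    have [P0|[c0 P1]] : P = [::] \/ exists c, P = [:: c].
    - by case: (P) szP => [|x []] //; [left|right; exists x].
    - apply: (@leq_trans #|(set0 : {set T * T})|); last by rewrite cards0.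
      by apply: subset_leq_card; apply/subsetP => x; rewrite !inE P0.
    apply: leq_trans (Jn c0).
    by apply: subset_leq_card; apply/subsetP => x; rewrite !inE P1 /= orbF => /andP[].
  by apply: card_bigcup_le => c'; rewrite inE => /andP[_ cP]; exact: cBw.
have cT : N <= #|G| + (#|B1| + (#|B2| + (#|B3| + (#|B4| + #|B5|)))).
  have hG : G \subset avoiding J P by apply/subsetP => s; rewrite inE => /andP[].
  have := cardsID G (avoiding J P); rewrite (setIidPr hG) -/N => <-.
  rewrite leq_add2l (leq_trans (subset_leq_card sub)) //.
  by do 4! (rewrite (leq_trans (leq_card_setU _ _)) // leq_add2l).
have M0 : 0 < M by lia.
have c3' : #|B3| * M <= D * (4 * N) by move: c3; rewrite expnS expn1; nia.
have c4' : #|B4| * M <= D * (8 * N).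
  move: c4; rewrite (_ : M ^ 3 = M * M * M) ?expnS ?expn0 ?muln1 ?mulnA // => c4.
  by rewrite -(@leq_pmul2l (M * M)) ?muln_gt0 ?M0 //; nia.
have c2' : #|B2| * M <= D * (4 * N) by move: c2; rewrite expnS expn1; nia.
have c5' : #|B5| * M <= D * (4 * N) by move: c5; rewrite expnS expn1; nia.
have : N * M <= #|G| * M + (D * (2*N) + (D * (4*N) + (D * (4*N) + (D * (8*N) + D*(4*N))))).
  apply: (@leq_trans ((#|G| + (#|B1| + (#|B2| + (#|B3| + (#|B4| + #|B5|))))) * M)).
    by rewrite leq_mul2r cT orbT.
  lia.
move=> h; apply: (leq_trans h); apply: leq_add; last by clearbody N; clear; nia.
by rewrite -mulnA mulnC leq_mul2l cG orbT.
Qed.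

End Switching.

(** * From conditional probabilities to an exponential *)

Section Product.
Variable R : realType.
Local Open Scope ring_scope.

Lemma expR_le_1B (y : R) : 0 <= y -> y <= 1/2 -> expR (- (y * (1 + 2 * y))) <= 1 - y.
Proof.
move=> y0 y1.
have h : (1 - y)^-1 <= expR (y * (1 + 2 * y)).
  apply: (@le_trans _ _ (1 + y * (1 + 2 * y))); last exact: expR_ge1Dx.
  rewrite -div1r ler_pdivrMr; last lra.
  have : 0 <= y ^+ 2 * (1 - 2 * y) by apply: mulr_ge0; [exact: sqr_ge0|lra].
  rewrite expr2; nra.
rewrite expRN -[leRHS]invrK lef_pV2 ?posrE ?expR_gt0 //.
by rewrite invr_gt0; lra.
Qed.

(** Each step multiplies [f] by [1 - q (1 + O (d))].  The hypothesis [q <= d]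
    absorbs the second-order term of [ln (1 - q)] into the relative error [d]. *)
Lemma product_estimate (B : Type) (f : seq B -> R) (A q d : R) (L : seq B) :
  0 < A -> 0 <= q -> q <= d -> d <= 1/8 -> f [::] = A ->
  (forall L1 b L2, L = L1 ++ b :: L2 ->
     (1 - d) * q * f L2 <= f L2 - f (b :: L2) <= (1 + d) * q * f L2) ->
  exists err : R, `|err| <= 9 * (size L)%:R * q * d /\
    f L = A * expR (- ((size L)%:R * q) + err).
Proof.
move=> A0 q0 qd d1 f0 step.
have [up lo] : f L <= A * expR (- ((size L)%:R * q * (1 - d))) /\
               A * expR (- ((size L)%:R * q * (1 + 9 * d))) <= f L.
  elim: L step => [|b L IH] step.
    by rewrite f0 !mul0r !oppr0 expR0 mulr1.
  have [|up lo] := IH; first by move=> L1 b' L2 e; apply: (step (b :: L1)); rewrite e.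
  have /andP[s1 s2] := step [::] b L erefl.
  have fL0 : 0 < f L by apply: lt_le_trans lo; rewrite mulr_gt0 ?expR_gt0.
  have e c : (size (b :: L))%:R * q * c = (size L)%:R * q * c + q * c by rewrite /= -natr1;
    ring.
  rewrite !e !opprD !expRD; split.
    apply: (@le_trans _ _ (f L * (1 - q * (1 - d)))); first by rewrite mulrBr mulr1; lra.
    rewrite mulrA; apply: ler_pM => //.
    - exact: ltW.
    - have : q * (1 - d) <= d * 1 by apply: ler_pM; lra.
      lra.
    - exact: expR_ge1Dx.
  apply: (@le_trans _ _ (f L * (1 - q * (1 + d)))); last by rewrite mulrBr mulr1; lra.
  rewrite mulrA; apply: ler_pM; rewrite ?mulr_ge0 ?expR_ge0 ?(ltW A0) //.
  have qd2 : q * (1 + d) <= 2 * q by nra.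
  apply: le_trans (expR_le_1B _ _); [|nra|lra].
  rewrite ler_expR lerN2.
  have : 0 <= q * (1+d) by nra.
  have : 0 <= q * (8 * d - d - 2 * q * (1+d)^+2); last by rewrite expr2; nra.
  apply: mulr_ge0 => //; have : (1+d)^+2 <= 2 by rewrite expr2; nra.
  by rewrite expr2; nra.
have fL0 : 0 < f L by apply: lt_le_trans lo; rewrite mulr_gt0 ?expR_gt0.
exists (ln (f L / A) + (size L)%:R * q); split; last first.
  rewrite addrC -addrA subrr addr0 lnK ?posrE ?divr_gt0 //.
  by rewrite mulrC divfK // gt_eqF.
have sq : 0 <= (size L)%:R * q by rewrite mulr_ge0.
have h1 : ln (f L / A) <= - ((size L)%:R * q * (1 - d)).
  by rewrite -ler_expR lnK ?posrE ?divr_gt0 // ler_pdivrMr // mulrC.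
have h2 : - ((size L)%:R * q * (1 + 9 * d)) <= ln (f L / A).
  by rewrite -ler_expR lnK ?posrE ?divr_gt0 // ler_pdivlMr // mulrC.
rewrite ler_norml; apply/andP; split; nra.
Qed.

End Product.

Section Count.
Variables (R : realType) (T : finType).
Implicit Types (L : seq ((T * T) * (T * T))) (b : (T * T) * (T * T)).

(** The forbidden pairs are kept in a list so that they can be imposed one by
    one; the relation is its symmetric closure. *)
Definition pairrel L : rel (T * T) :=
  [rel c c' | ((c, c') \in L) || ((c', c) \in L)].

Lemma sparse_sub (J J' : rel (T * T)) D :
  sparse J D -> symmetric J' -> subrel J' J -> sparse J' D.
Proof.
case=> _ h1 h2 h3 h4 h5 h6 Js sub; split=> //.
- move=> c; apply: leq_trans (h1 c); apply: subset_leq_card.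
  by apply/subsetP => x; rewrite !inE; apply: sub.
- move=> s i; apply: leq_trans (h2 s i); apply: subset_leq_card.
  by apply/subsetP => x; rewrite !inE => /existsP[i' /sub h]; apply/existsP; exists i'.
- move=> s i; apply: leq_trans (h3 s i); apply: subset_leq_card.
  by apply/subsetP => x; rewrite !inE => /existsP[i' /sub h]; apply/existsP; exists i'.
- move=> s i j; apply: leq_trans (h4 s i j); apply: subset_leq_card.
  by apply/subsetP => x; rewrite !inE; apply: sub.
- move=> i; apply: leq_trans (h5 i); apply: subset_leq_card.
  by apply/subsetP => x; rewrite !inE; apply: sub.
- move=> i; apply: leq_trans (h6 i); apply: subset_leq_card.
  by apply/subsetP => x; rewrite !inE; apply: sub.
Qed.

Lemma pairrelE L c c' : pairrel L c c' = ((c, c') \in L) || ((c', c) \in L).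
Proof. by []. Qed.

Lemma pairrel_sym L : symmetric (pairrel L).
Proof. by move=> c c'; rewrite !pairrelE orbC. Qed.

Lemma card_avoiding_nil : #|avoiding (pairrel [::]) [::]| = #|T| `!.
Proof.
rewrite -cardsT -card_perm; apply: eq_card => s; rewrite !inE andbT.
transitivity true; first by apply/avoidsP => i i'.
by symmetry; apply/subsetP => x; rewrite inE.
Qed.

Lemma avoiding_cons L b :
  #|avoiding (pairrel (b :: L)) [::]| + #|avoiding (pairrel L) [:: b.2; b.1]|
  = #|avoiding (pairrel L) [::]|.
Proof.
rewrite -[RHS](cardsID [set s : {perm T} | (s b.1.1 == b.1.2) && (s b.2.1 == b.2.2)]) addnC.
congr (_ + _); apply: eq_card => s; rewrite !inE /= ?andbT.
  by rewrite [X in _ && X = _]andbC.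
case: b => -[p x] [q y] /=.
have av_cons : avoids (pairrel ((p, x, (q, y)) :: L)) s =
    avoids (pairrel L) s && ~~ ((s p == x) && (s q == y)).
  apply/idP/idP.
    move=> /avoidsP h; apply/andP; split.
      by apply/avoidsP => i i'; apply: contra (h i i'); rewrite !pairrelE !inE => /orP[] ->;
        rewrite !orbT.
    by apply/negP => /andP[/eqP e1 /eqP e2]; have := h p q; rewrite pairrelE e1 e2 inE eqxx.
  move=> /andP[/avoidsP h nh]; apply/avoidsP => i i'; apply/negP.
  rewrite pairrelE !inE -!orbA => /or4P[/eqP[e1 e2 e3 e4]|h'|/eqP[e1 e2 e3 e4]|h'].
  - by move/negP: nh; apply; rewrite -e1 -e3 e2 e4 !eqxx.
  - by have := h i i'; rewrite pairrelE h'.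
  - by move/negP: nh; apply; rewrite -e1 -e3 e2 e4 !eqxx.
  - by have := h i i'; rewrite pairrelE h' orbT.
by rewrite av_cons andbC.
Qed.

Local Open Scope ring_scope.

(** Probability of hitting [c] for a random permutation avoiding [J].  The
    constant 44 is the one that [pair_hit] needs. *)
Lemma single_hit (J : rel (T * T)) (D : nat) (c : T * T) :
  sparse J D -> (0 < D)%N -> (100 * D <= #|T|)%N -> ~~ J c c ->
  let d : R := 44 * D%:R / #|T|%:R in let q : R := #|T|%:R^-1 in
  let N : R := #|avoiding J [::]|%:R in
  (1 - d) * q * N <= #|avoiding J [:: c]|%:R /\
  #|avoiding J [:: c]|%:R <= (1 + d) * q * N.
Proof.
move=> sJ D0 hT nJ d q N.
have hT' : (2 * (5 * D + 8) <= #|T|)%N by lia.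
have no : forall c', c' \in [::] -> ~~ J c c' by [].
have lo := @lower_step _ J D c [::] sJ hT' isT isT isT nJ no.
have up := @upper_step _ J D c [::] sJ isT.
have h5 : (5 * D <= #|T|)%N by lia.
move: lo up; rewrite /= subn0 -!(ler_nat R) !natrD !natrM -/N natrB //.
set X : R := #|avoiding J [:: c]|%:R; rewrite natrM.
set M : R := #|T|%:R => lo up.
have M100 : 100 * D%:R <= M by rewrite -natrM ler_nat.
have D1 : 1 <= D%:R :> R by rewrite ler1n.
have M0 : 0 < M by lra.
have N0 : 0 <= N by rewrite ler0n.
have X0 : 0 <= X by rewrite ler0n.
have dM : d * M = 44 * D%:R by rewrite /d divfK // gt_eqF.
have qM : q * M = 1 by rewrite /q mulVf // gt_eqF.
have q0 : 0 < q by rewrite /q invr_gt0.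
have d0 : 0 <= d by rewrite /d divr_ge0 //; lra.
have dhalf : d <= 1/2 by rewrite /d ler_pdivrMr //; lra.
split.
  rewrite -(ler_pM2r (_ : 0 < M * M)); last exact: mulr_gt0.
  have -> : (1 - d) * q * N * (M * M) = (N * M - (d * M) * N) * (q * M) by ring.
  rewrite dM qM mulr1; nra.
rewrite -(ler_pM2r M0).
have -> : (1 + d) * q * N * M = (1 + d) * N * (q * M) by ring.
rewrite qM mulr1.
have up' : X * (M - 5 * D%:R) * (1 + d) <= N * (1 + d) by rewrite ler_wpM2r //; lra.
have : X * M <= X * (M - 5 * D%:R) * (1 + d); last by lra.
rewrite -mulrA ler_wpM2l //.
have -> : (M - 5 * D%:R) * (1 + d) = M + (d * M) - 5 * D%:R - 5 * (D%:R * d) by ring.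
rewrite dM; have : D%:R * d <= D%:R * (1/2) by rewrite ler_wpM2l.
lra.
Qed.

(** The two switchings, applied first to [c] and then to [c'] with [c]
    prescribed.  Each of the two lower estimates loses a factor
    [1 - 22 * D / #|T|], hence the constant 44; the upper ones lose less. *)
Lemma pair_hit (J : rel (T * T)) (D : nat) (c c' : T * T) :
  sparse J D -> (0 < D)%N -> (100 * D <= #|T|)%N -> ~~ J c c -> ~~ J c' c' -> ~~ J c c' ->
  c.1 != c'.1 -> c.2 != c'.2 ->
  let d : R := 44 * D%:R / #|T|%:R in let q : R := (#|T|%:R ^+ 2)^-1 in
  let N : R := #|avoiding J [::]|%:R in
  (1 - d) * q * N <= #|avoiding J [:: c'; c]|%:R /\
  #|avoiding J [:: c'; c]|%:R <= (1 + d) * q * N.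
Proof.
move=> sJ D0 hT nJ nJ' nJJ r1 r2 d q N.
have hT' : (2 * (5 * D + 8) <= #|T|)%N by lia.
have no : forall c', c' \in [::] -> ~~ J c c' by [].
have lo1 := @lower_step _ J D c [::] sJ hT' isT isT isT nJ no.
have Jsym := sparse_sym sJ.
have nJJ' : forall c'', c'' \in [:: c] -> ~~ J c' c''.
  by move=> c''; rewrite inE => /eqP ->; rewrite Jsym.
have r1' : c'.1 \notin unzip1 [:: c] by rewrite inE eq_sym.
have r2' : c'.2 \notin unzip2 [:: c] by rewrite inE eq_sym.
have lo2 := @lower_step _ J D c' [:: c] sJ hT' isT r1' r2' nJ' nJJ'.
have up1 := @upper_step _ J D c [::] sJ isT.
have up2 := @upper_step _ J D c' [:: c] sJ r1'.
have h1 : (1 <= #|T|)%N by lia.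
have h5 : (5 * D <= #|T|)%N by lia.
have h5' : (5 * D <= #|T| - 1)%N by lia.
move: lo1 lo2 up1 up2; rewrite /= subn0 -!(ler_nat R) !natrD !natrM -/N !natrB ?natrM //.
set Y : R := #|avoiding J [:: c]|%:R.
set X : R := #|avoiding J [:: c'; c]|%:R.
set M : R := #|T|%:R => lo1 lo2 up1 up2.
have M100 : 100 * D%:R <= M by rewrite -natrM ler_nat.
have D1 : 1 <= D%:R :> R by rewrite ler1n.
have M0 : 0 < M by lra.
have N0 : 0 <= N by rewrite ler0n.
have X0 : 0 <= X by rewrite ler0n.
have Y0 : 0 <= Y by rewrite ler0n.
pose t : R := D%:R / M.
have tM : t * M = D%:R by rewrite /t divfK // gt_eqF.
have dt : d = 44 * t by rewrite /d /t mulrA.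
have t1 : t <= 1/100 by rewrite /t ler_pdivrMr //; lra.
have t0 : 0 <= t by rewrite /t divr_ge0 //; lra.
have qM : q * (M * M) = 1 by rewrite /q -expr2 mulVf // expf_neq0 // gt_eqF.
have l1 : N * (1 - 22 * t) <= M * Y.
  rewrite -(ler_pM2l M0).
  have -> : M * (N * (1 - 22 * t)) = N * M - 22 * (t * M) * N by ring.
  by rewrite tM; lra.
have l2 : Y * (1 - 22 * t) <= M * X.
  rewrite -(ler_pM2l M0).
  have -> : M * (Y * (1 - 22 * t)) = Y * M - 22 * (t * M) * Y by ring.
  by rewrite tM; lra.
have u1 : Y * M * (1 - 6 * t) <= N.
  apply: le_trans up1; rewrite -mulrA ler_wpM2l //.
  by rewrite mulrBr mulr1 mulrCA [M * t]mulrC tM; lra.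
have u2 : X * M * (1 - 6 * t) <= Y.
  apply: le_trans up2; rewrite -mulrA ler_wpM2l //.
  by rewrite mulrBr mulr1 mulrCA [M * t]mulrC tM; lra.
rewrite dt; split; rewrite -(ler_pM2r (_ : 0 < M * M)) ?mulr_gt0 //.
  have -> : (1 - 44 * t) * q * N * (M * M) = N * (1 - 44 * t) * (q * (M * M)) by ring.
  rewrite qM mulr1.
  apply: (@le_trans _ _ (N * (1 - 22 * t) * (1 - 22 * t))).
    by rewrite -mulrA ler_wpM2l //; nra.
  apply: (@le_trans _ _ (M * Y * (1 - 22 * t))); first by rewrite ler_wpM2r //; lra.
  by rewrite -mulrA [X * _]mulrC -mulrA ler_wpM2l // ltW.
have -> : (1 + 44 * t) * q * N * (M * M) = N * (1 + 44 * t) * (q * (M * M)) by ring.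
rewrite qM mulr1.
have hX : X * (M * M) * ((1 - 6 * t) * (1 - 6 * t)) <= N.
  apply: le_trans u1.
  have -> : X * (M * M) * ((1 - 6 * t) * (1 - 6 * t)) =
    (X * M * (1 - 6 * t)) * (M * (1 - 6 * t)) by ring.
  rewrite -[leRHS]mulrA ler_wpM2r //; apply: mulr_ge0; lra.
apply: (@le_trans _ _ (X * (M * M) * ((1 - 6 * t) * (1 - 6 * t)) * (1 + 44 * t))).
  rewrite -[leRHS]mulrA -[leLHS]mulr1; apply: ler_wpM2l; first by rewrite !mulr_ge0 // ltW.
  have t3 := mulr_ge0 (mulr_ge0 t0 t0) t0.
  have : 0 <= t * (1/100 - t) by rewrite mulr_ge0 // subr_ge0.
  lra.
by rewrite ler_wpM2r //; lra.
Qed.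

Lemma avoiding_consB L b :
  #|avoiding (pairrel L) [::]|%:R - #|avoiding (pairrel (b :: L)) [::]|%:R
  = #|avoiding (pairrel L) [:: b.2; b.1]|%:R :> R.
Proof. by rewrite -(avoiding_cons L b) natrD addrAC subrr add0r. Qed.

(** Requiring that the reversal of a listed pair is not listed ensures that
    each forbidden pair of cells is counted once in [size L]. *)
Lemma count_avoiding_pairs (J : rel (T * T)) (D : nat) L :
  sparse J D -> (0 < D)%N -> (400 * D <= #|T|)%N -> uniq L ->
  (forall b, b \in L -> [/\ J b.1 b.2, b.1.1 != b.2.1, b.1.2 != b.2.2 & (b.2, b.1) \notin L]) ->
  let q : R := (#|T|%:R ^+ 2)^-1 in
  exists err : R, `|err| <= 9 * (size L)%:R * q * (44 * D%:R / #|T|%:R) /\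
    #|avoiding (pairrel L) [::]|%:R = (#|T| `!)%:R * expR (- ((size L)%:R * q) + err).
Proof.
move=> sJ D0 hT uL hL q.
have M400 : 400 * D%:R <= #|T|%:R :> R by rewrite -natrM ler_nat.
have D1 : 1 <= D%:R :> R by rewrite ler1n.
have M0 : 0 < #|T|%:R :> R by lra.
apply: (product_estimate (f := fun L => #|avoiding (pairrel L) [::]|%:R)).
- by rewrite ltr0n fact_gt0.
- by rewrite invr_ge0 exprn_ge0.
- rewrite /q expr2 invfM ler_pM2r ?invr_gt0 //.
  by apply: (@le_trans _ _ 1); [rewrite invf_le1 //|]; lra.
- by rewrite ler_pdivrMr //; lra.
- by rewrite card_avoiding_nil.
- move=> L1 b L2 eL.
  have bL : b \in L by rewrite eL mem_cat mem_head orbT.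
  have sub x : x \in L2 -> x \in L by move=> h; rewrite eL mem_cat inE h !orbT.
  have [_ b1 b2 nb] := hL b bL.
  have sJ2 : sparse (pairrel L2) D.
    apply: (sparse_sub sJ); first exact: pairrel_sym.
    move=> c c'; rewrite pairrelE => /orP[] /sub /hL[] //=.
    by rewrite (sparse_sym sJ).
  have nbL2 : b \notin L2.
    by move: uL; rewrite eL cat_uniq /= => /and3P[_ _ /andP[]].
  have irr c : ~~ pairrel L2 c c.
    by rewrite pairrelE orbb; apply/negP => /sub /hL[_]; rewrite eqxx.
  have nbb : ~~ pairrel L2 b.1 b.2.
    rewrite pairrelE negb_or -surjective_pairing nbL2 /=; apply: contra nb; exact: sub.
  have hT' : (100 * D <= #|T|)%N by apply: leq_trans hT; rewrite leq_mul2r orbT.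
  have [h1 h2] := pair_hit sJ2 D0 hT' (irr _) (irr _) nbb b1 b2.
  by rewrite avoiding_consB; apply/andP.
Qed.

Definition cellrel (B : {set T * T}) : rel (T * T) := [rel c c' | (c == c') && (c \in B)].

Lemma avoids_cellrel B s : avoids (cellrel B) s = [forall i, (i, s i) \notin B].
Proof.
apply/avoidsP/forallP => [h i|h i i']; first by have := h i i; rewrite /cellrel /= eqxx.
by rewrite /cellrel /= negb_and h orbT.
Qed.

Lemma count_avoiding_cells (B : {set T * T}) (D : nat) :
  sparse (cellrel B) D -> (0 < D)%N -> (400 * D <= #|T|)%N ->
  let q : R := #|T|%:R^-1 in
  exists err : R, `|err| <= 9 * #|B|%:R * q * (44 * D%:R / #|T|%:R) /\
    #|avoiding (cellrel B) [::]|%:R = (#|T| `!)%:R * expR (- (#|B|%:R * q) + err).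
Proof.
move=> sJ D0 hT q.
have M400 : 400 * D%:R <= #|T|%:R :> R by rewrite -natrM ler_nat.
have D1 : 1 <= D%:R :> R by rewrite ler1n.
have M0 : 0 < #|T|%:R :> R by lra.
pose dup (c : T * T) := (c, c).
have dupI : injective dup by move=> c c' [].
have eJ : avoiding (cellrel B) [::] = avoiding (pairrel (map dup (enum B))) [::].
  apply/setP => s; rewrite !inE !andbT; apply: eq_forallb => i; apply: eq_forallb => i'.
  have aux c c' : ((c, c') \in map dup (enum B)) = (c == c') && (c \in B).
    apply/mapP/andP => [[x xB [-> ->]]|[/eqP <- cB]].
      by rewrite eqxx -mem_enum.
    by exists c; rewrite ?mem_enum.
  rewrite pairrelE !aux /cellrel /=.
  rewrite [X in _ || X](_ : _ = ((i, s i) == (i', s i')) && ((i, s i) \in B)) ?orbb //.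
  by rewrite eq_sym; case: eqP => // ->.
have sL : size (map dup (enum B)) = #|B| by rewrite size_map -cardE.
rewrite eJ -sL.
apply: (product_estimate (f := fun L => #|avoiding (pairrel L) [::]|%:R)).
- by rewrite ltr0n fact_gt0.
- by rewrite invr_ge0.
- rewrite /q ler_pdivlMr // mulVf ?gt_eqF //; lra.
- by rewrite ler_pdivrMr //; lra.
- by rewrite card_avoiding_nil.
- move=> L1 b L2 eL.
  have bL : b \in map dup (enum B) by rewrite eL mem_cat mem_head orbT.
  have sub x : x \in L2 -> x \in map dup (enum B) by move=> h; rewrite eL mem_cat inE h !orbT.
  have sJ2 : sparse (pairrel L2) D.
    apply: (sparse_sub sJ); first exact: pairrel_sym.
    by move=> c c'; rewrite pairrelE => /orP[] /sub /mapP[x + [-> ->]];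
      rewrite mem_enum /cellrel /= eqxx.
  have nbL2 : b \notin L2.
    have : uniq (map dup (enum B)) by rewrite map_inj_uniq // enum_uniq.
    by rewrite eL cat_uniq /= => /and3P[_ _ /andP[]].
  have /mapP[c cB eb] := bL.
  have irr : ~~ pairrel L2 c c by rewrite pairrelE orbb -/(dup c) -eb.
  have hT' : (100 * D <= #|T|)%N by apply: leq_trans hT; rewrite leq_mul2r orbT.
  have [h1 h2] := single_hit sJ2 D0 hT' irr.
  have ec : #|avoiding (pairrel L2) [:: c; c]| = #|avoiding (pairrel L2) [:: c]|.
    by apply: eq_card => s; rewrite !inE /= !andbT andbb.
  by rewrite avoiding_consB eb /= ec; apply/andP.
Qed.

End Count.

(** * Simple pairings between vertices and hyperarcs *)

Section Pairing.
Variables (M : nat) (V E : finType) (u : 'I_M -> V) (w : 'I_M -> E) (Dl : nat).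
Hypothesis uD : forall v, #|[set i | u i == v]| <= Dl.
Hypothesis wD : forall e, #|[set i | w i == e]| <= Dl.
Local Notation T := 'I_M.

(** For a pairing [s] of the points of the vertices with the points of the
    hyperarcs, two hit cells are parallel when they join the same vertex to the
    same hyperarc. *)
Definition parallel : rel (T * T) :=
  [rel c c' | [&& u c.1 == u c'.1, w c.2 == w c'.2, c.1 != c'.1 & c.2 != c'.2]].

(** A point has at most [Dl] companions at its vertex, and a hyperarc at most
    [Dl] points, so that every local choice is among [Dl * Dl]. *)
Lemma sparse_parallel : 0 < Dl -> sparse parallel (Dl * Dl).
Proof.
move=> D0; split.
- move=> c c'; rewrite /parallel /= eq_sym [w _ == _]eq_sym [c.1 == _]eq_sym [c.2 == _]eq_sym.
  by [].
- move=> c; apply: leq_trans (leq_mul (uD (u c.1)) (wD (w c.2))).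
  rewrite -cardsX; apply: subset_leq_card; apply/subsetP => -[p x].
  by rewrite !inE /parallel /= => /and4P[/eqP -> /eqP -> _ _]; rewrite !eqxx.
- move=> s i.
  have sub : [set a | [exists i', parallel (i, s a) (i', s i')]] \subset
     \bigcup_(i' in [set i' | u i' == u i]) [set a | s a \in [set x | w x == w (s i')]].
    apply/subsetP => a; rewrite inE => /existsP[i'] /and4P[/= h1 h2 _ _].
    by apply/bigcupP; exists i'; rewrite !inE // eq_sym.
  apply: leq_trans (subset_leq_card sub) _.
  apply: leq_trans (card_bigcup_const (L := Dl) _) _.
    by move=> i' _; rewrite card_perm_preim.
  by rewrite leq_mul2r uD orbT.
- move=> s j.
  have sub : [set a | [exists i', parallel (a, j) (i', s i')]] \subset
     \bigcup_(i' in [set i' | s i' \in [set x | w x == w j]]) [set a | u a == u i'].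
    apply/subsetP => a; rewrite inE => /existsP[i'] /and4P[/= h1 h2 _ _].
    by apply/bigcupP; exists i'; rewrite !inE // eq_sym.
  apply: leq_trans (subset_leq_card sub) _.
  apply: leq_trans (card_bigcup_const (L := Dl) _) _ => //.
  by rewrite card_perm_preim leq_mul2r wD orbT.
- move=> s i j; apply: leq_trans (_ : Dl <= _); last by rewrite leq_pmulr.
  apply: leq_trans (uD (u i)); apply: subset_leq_card; apply/subsetP => a.
  by rewrite !inE => /and4P[/= h1 _ _ _]; rewrite eq_sym.
- move=> i; apply: leq_trans (_ : 0 <= _) => //.
  by rewrite leqn0 cards_eq0; apply/eqP/setP => z; rewrite !inE /parallel /= !eqxx andbF.
- move=> i; apply: leq_trans (_ : 0 <= _) => //.
  by rewrite leqn0 cards_eq0; apply/eqP/setP => z; rewrite !inE /parallel /= !eqxx andbF.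
Qed.

Definition simple : {set {perm T}} := avoiding parallel [::].

Lemma simpleP (s : {perm T}) :
  reflect (injective (fun i => (u i, w (s i)))) (s \in simple).
Proof.
rewrite inE andbT; apply: (iffP (avoidsP _ _)) => [h i i' [e1 e2]|h i i'].
  apply/eqP; have := h i i'; rewrite /parallel /= e1 e2 !eqxx /= negb_and !negbK.
  by case/orP => // /eqP /perm_inj ->.
apply/negP => /and4P[/= /eqP e1 /eqP e2 /eqP ne _].
by apply: ne; apply: h; rewrite e1 e2.
Qed.

(** Ordering the two rows picks one of the two orders of each parallel pair. *)
Definition parallel_pairs : {set (T * T) * (T * T)} :=
  [set b | parallel b.1 b.2 && (b.1.1 < b.2.1)].

Lemma avoiding_parallel_pairs : avoiding (pairrel (enum parallel_pairs)) [::] = simple.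
Proof.
apply/setP => s; rewrite !inE !andbT; apply: eq_forallb => i; apply: eq_forallb => i'.
rewrite pairrelE !mem_enum !inE /=; congr (~~ _).
rewrite /parallel /= [u i' == _]eq_sym [w (s i') == _]eq_sym [i' == _]eq_sym [s i' == _]eq_sym.
rewrite -andb_orr -neq_ltn -[RHS]andbT -!andbA; do 2!congr (_ && _).
have [->|ni] := eqVneq i i'; first by rewrite eqxx.
by have -> : (i : nat) != i' by [].
Qed.

(** A parallel pair of cells is an unordered pair of points at one vertex
    together with an ordered pair of points of one hyperarc. *)
Lemma card_parallel_pairs :
  2 * #|parallel_pairs| =
  (\sum_v #|[set i | u i == v]| ^_ 2) * (\sum_e #|[set i | w i == e]| ^_ 2).
Proof.
rewrite -!card_fibre_pairs.
set U := [set x : T * T | (u x.1 == u x.2) && (x.1 != x.2)].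
set W := [set x : T * T | (w x.1 == w x.2) && (x.1 != x.2)].
pose U1 := [set x in U | x.1 < x.2].
have -> : #|U| = 2 * #|U1|.
  rewrite -(cardsID [set x : T * T | x.1 < x.2] U) mul2n -addnn; congr (_ + _).
    by apply: eq_card => x; rewrite !inE.
  have swI : injective (fun x : T * T => (x.2, x.1)) by move=> [p q] [p' q'] [-> ->].
  rewrite -(card_imset U1 swI); apply: eq_card => -[p q]; rewrite !inE /=.
  apply/idP/imsetP => [/and3P[h1 h2 h3]|[[p' q']]].
    exists (q, p) => //; rewrite !inE /= eq_sym h2 eq_sym h3 /=.
    by rewrite ltn_neqAle leqNgt h1 andbT; rewrite eq_sym -(inj_eq val_inj) in h3.
  rewrite !inE /= => /andP[/andP[h1 h2] h3] [-> ->].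
  by rewrite -leqNgt (ltnW h3) eq_sym h1 eq_sym h2.
rewrite -mulnA; congr (2 * _); rewrite -cardsX.
pose g (b : (T * T) * (T * T)) := ((b.1.1, b.2.1), (b.1.2, b.2.2)).
have gI : injective g by move=> [[p x] [q y]] [[p' x'] [q' y']] [-> -> -> ->].
rewrite -(card_imset parallel_pairs gI); apply: eq_card => -[[p q] [x y]].
rewrite !inE /=; apply/imsetP/idP =>
  [[[[p' x'] [q' y']]]|/andP[/andP[/andP[h1 h2] h3] /andP[h4 h5]]].
  by rewrite !inE /parallel /= => /andP[/and4P[h1 h2 h3 h4] h5] [-> -> -> ->];
    rewrite h1 h2 h3 h4 h5.
by exists ((p, x), (q, y)) => //; rewrite !inE /parallel /= h1 h2 h3 h4 h5.
Qed.

(** With [q = 1 / M^2] and [D = Dl^2], the error [9 * N * q * 44 * D / M] is at most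
    [198 * Dl^4 / M] because [2 * N = S2 * T2 <= (Dl * M)^2]. *)
Lemma count_simple (R : realType) : 0 < Dl -> 400 * (Dl * Dl) <= M ->
  let S2 := \sum_v #|[set i | u i == v]| ^_ 2 in
  let T2 := \sum_e #|[set i | w i == e]| ^_ 2 in
  exists err : R, (`|err| <= 198 * (Dl%:R ^+ 4 / M%:R) /\
    #|simple|%:R = (M`!)%:R * expR (- (S2%:R * T2%:R / (2 * M%:R ^+ 2)) + err))%R.
Proof.
move=> D0 hM S2 T2.
have DD0 : 0 < Dl * Dl by rewrite muln_gt0 D0.
have sp := sparse_parallel D0.
have hT : 400 * (Dl * Dl) <= #|T| by rewrite card_ord.
have [|err [e1 e2]] := count_avoiding_pairs R sp DD0 hT (enum_uniq parallel_pairs).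
  move=> b; rewrite mem_enum inE => /andP[Jb lt]; have /and4P[_ _ h1 h2] := Jb.
  split=> //; rewrite mem_enum inE /= negb_and -leqNgt (ltnW lt) orbT //.
move: e1 e2; rewrite avoiding_parallel_pairs card_ord -cardE => e1 e2.
have ST : (2 * #|parallel_pairs|%:R = S2%:R * T2%:R :> R)%R.
  by rewrite -!natrM card_parallel_pairs.
have bnd (X : finType) (p : T -> X) : (forall x, #|[set i | p i == x]| <= Dl) ->
    \sum_x #|[set i | p i == x]| ^_ 2 <= M * Dl.
  move=> pD; apply: (@leq_trans (\sum_x #|[set i | p i == x]| * Dl)).
    apply: leq_sum => x _; rewrite ffactnS ffactn1 leq_mul2l.
    by rewrite (leq_trans (leq_pred _)) ?orbT.
  by rewrite -(sum_by_fibre p (fun _ => Dl)) sum_nat_const card_ord.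
have M0 : (0 < M%:R :> R)%R.
  by rewrite ltr0n; apply: leq_trans hM; rewrite muln_gt0.
exists err; split; last first.
  have -> : (S2%:R * T2%:R / (2 * M%:R ^+ 2) = #|parallel_pairs|%:R * M%:R ^- 2 :> R)%R.
    by rewrite -ST; field; rewrite gt_eqF.
  exact: e2.
apply: le_trans e1 _.
have -> : (9 * #|parallel_pairs|%:R * M%:R ^- 2 * (44 * (Dl * Dl)%:R / M%:R)
  = 198 * (Dl%:R ^+ 2) / M%:R * ((2 * #|parallel_pairs|%:R) / M%:R ^+ 2) :> R)%R.
  by rewrite natrM; field; rewrite gt_eqF.
rewrite ST.
have -> : (198 * (Dl%:R ^+ 4 / M%:R) = 198 * Dl%:R ^+ 2 / M%:R * Dl%:R ^+ 2 :> R)%R.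
  by field; rewrite gt_eqF.
apply: ler_wpM2l; first by rewrite !mulr_ge0 // invr_ge0 ltW.
rewrite ler_pdivrMr ?exprn_gt0 // -exprMn expr2 -!natrM ler_nat mulnC [Dl * M]mulnC.
by apply: leq_mul; apply: bnd.
Qed.

(** Two given points [x1], [x2] of a hyperarc are matched to vertices that also
    meet the hyperarc [f] only if the pairing hits four cells, whose choice
    amounts to two pairs of points at a common vertex and two points of [f]. *)
Lemma simple_repeat (x1 x2 : T) (f : E) :
  0 < Dl -> 400 * (Dl * Dl) <= M -> x1 != x2 -> w x1 = w x2 -> w x1 != f ->
  #|[set s in simple | [exists y, (u y == u ((s^-1)%g x1)) && (w (s y) == f)]
      && [exists y, (u y == u ((s^-1)%g x2)) && (w (s y) == f)]]| * M ^ 2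
  <= 16 * Dl ^ 2 * #|[set i | w i == f]| ^ 2 * #|simple|.
Proof.
move=> D0 hM x12 wx wf.
set X := [set s in simple | _].
have sp := sparse_parallel D0.
pose A1 := [set p : T * T | u p.2 == u p.1].
pose F := [set i | w i == f].
pose A := [set a : ((T * T) * (T * T)) * (T * T) |
  [&& a \in setX (setX A1 A1) (setX F F) & uniq [:: a.1.1.1; a.1.2.1; a.1.1.2; a.1.2.2]]].
pose P (a : ((T * T) * (T * T)) * (T * T)) : seq (T * T) :=
  [:: (a.1.1.1, x1); (a.1.2.1, x2); (a.1.1.2, a.2.1); (a.1.2.2, a.2.2)].
have sub : X \subset \bigcup_(a in A) avoiding parallel (P a ++ [::]).
  apply/subsetP => s; rewrite inE =>
    /and3P[ss /existsP[q1 /andP[/eqP u1 w1]] /existsP[q2 /andP[/eqP u2 w2]]].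
  have inj := simpleP _ ss.
  set p1 := (s^-1)%g x1 in u1; set p2 := (s^-1)%g x2 in u2.
  have s1 : s p1 = x1 by rewrite permKV.
  have s2 : s p2 = x2 by rewrite permKV.
  apply/bigcupP; exists (((p1, q1), (p2, q2)), (s q1, s q2)); last first.
    by move: ss; rewrite !inE /= s1 s2 !eqxx !andbT.
  rewrite !inE /= u1 u2 !eqxx w1 w2 /= andbT !negb_or.
  have n12 : p1 != p2 by apply: contra x12 => /eqP e; rewrite -s1 -s2 e.
  have hne p q : w (s p) = w x1 -> w (s q) == f -> p != q.
    by move=> e1 /eqP e2; apply: contra wf => /eqP e; rewrite -e2 -e e1.
  rewrite n12 (hne p1 q1) ?(hne p1 q2) ?(hne p2 q1) ?(hne p2 q2) ?s1 ?s2 //= andbT.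
  apply: contra n12 => /eqP e; apply/eqP; apply: inj.
  by rewrite s1 s2 wx -u1 -u2 e.
have cA : #|A| <= (M * Dl) ^ 2 * #|F| ^ 2.
  apply: (@leq_trans #|setX (setX A1 A1) (setX F F)|).
    by apply: subset_leq_card; apply/subsetP => a; rewrite inE => /andP[].
  rewrite !cardsX -!mulnn leq_mul2r; apply/orP; right.
  have cA1 : #|A1| <= M * Dl.
    have -> : A1 = [set p : T * T | xpredT p.1 && (u p.2 == u p.1)] by [].
    rewrite (card_dep_pair xpredT (fun p q => u q == u p)).
    rewrite -[X in X * Dl]card_ord -sum_nat_const; apply: leq_sum => i _.
    by apply: leq_trans (uD (u i)); rewrite cardsE.
  exact: leq_mul.
have h : #|X| * M ^ 4 <= #|A| * (2 ^ 4 * #|simple|).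
  apply: (@leq_trans (#|\bigcup_(a in A) avoiding parallel (P a ++ [::])| * M ^ 4)).
    by rewrite leq_mul2r subset_leq_card ?orbT.
  apply: card_bigcup_le => a; rewrite inE => /andP[_ ua].
  have := @upper_mul _ parallel (Dl * Dl) [::] (P a) sp; rewrite card_ord; apply=> //.
  by move: hM; nia.
have M0 : 0 < M by apply: leq_trans hM; rewrite !muln_gt0 D0.
rewrite -(@leq_pmul2r (M ^ 2)) ?expn_gt0 ?M0 // -mulnA -expnD.
apply: leq_trans h _; apply: leq_trans (leq_mul cA (leqnn _)) _.
apply: eq_leq; rewrite -[2 ^ 4]/16 expnMn; ring.
Qed.

End Pairing.

(** * Head assignments without loops *)

Section Heads.
Variables (m : nat) (V : finType) (z : 'I_m -> V) (t : 'I_m -> {set V}) (Dl : nat).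
Hypothesis zD : forall v, #|[set i | z i == v]| <= Dl.
Hypothesis tD : forall e, #|t e| <= Dl.
Hypothesis tdeg : forall v, #|[set e | v \in t e]| <= Dl.
Local Notation T := 'I_m.

(** Cells [(e, i)]: giving hyperarc [e] the in-point [i] as head would put the
    head inside the tail. *)
Definition loops : {set T * T} := [set c | z c.2 \in t c.1].

Lemma sparse_loops : 0 < Dl -> sparse (cellrel loops) (Dl * Dl).
Proof.
move=> D0.
have small (A : {set T}) x : (forall y, y \in A -> y = x) -> #|A| <= Dl * Dl.
  move=> h; apply: (@leq_trans 1); last by rewrite muln_gt0 D0.
  rewrite -(cards1 x); apply: subset_leq_card; apply/subsetP => y /h ->.
  by rewrite inE.
split.
- move=> c c'; rewrite /cellrel /=; case: eqVneq => [->|]; rewrite ?eqxx //.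
- move=> c; apply: (@leq_trans 1); last by rewrite muln_gt0 D0.
  rewrite -(cards1 c); apply: subset_leq_card; apply/subsetP => c'.
  by rewrite !inE /cellrel /= => /andP[/eqP -> _]; rewrite eqxx.
- move=> s i; apply: (small _ i) => y; rewrite inE => /existsP[i'].
  by rewrite /cellrel /= => /andP[/eqP[-> /perm_inj ->]].
- move=> s j; apply: (small _ ((s^-1)%g j)) => y; rewrite inE => /existsP[i'].
  by rewrite /cellrel /= => /andP[/eqP[-> ->] _]; rewrite permK.
- move=> s i j; apply: (small _ i) => y; rewrite inE.
  by rewrite /cellrel /= => /andP[/eqP[-> _]].
- move=> i; apply: (@leq_trans #|\bigcup_(v in t i) [set j | z j == v]|).
    apply: subset_leq_card; apply/subsetP => j; rewrite !inE /cellrel /= eqxx inE /= => h.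
    by apply/bigcupP; exists (z j) => //; rewrite inE.
  apply: leq_trans (card_bigcup_const (L := Dl) _) _ => [v _|]; first exact: zD.
  by rewrite leq_mul2r tD orbT.
- move=> j; apply: (@leq_trans Dl); last by rewrite leq_pmulr.
  apply: leq_trans (tdeg (z j)); apply: subset_leq_card; apply/subsetP => a.
  by rewrite !inE /cellrel /= eqxx inE.
Qed.

(** Only the degrees of [t] enter, so all tail families with the prescribed
    out-degrees forbid the same number of cells. *)
Lemma card_loops : #|loops| = \sum_v #|[set i | z i == v]| * #|[set e | v \in t e]|.
Proof.
rewrite -(sum_by_fibre z (fun v => #|[set e | v \in t e]|)).
have swI : injective (fun x : T * T => (x.2, x.1)) by move=> [p q] [p' q'] [-> ->].
rewrite -(card_imset loops swI).
transitivity #|[set x : T * T | xpredT x.1 && (z x.1 \in t x.2)]|.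
  apply: eq_card => -[p q]; rewrite [RHS]inE /=; apply/imsetP/idP => [[[p' q'] + [-> ->]]|h].
    by rewrite inE.
  by exists (q, p); rewrite ?inE.
rewrite (card_dep_pair xpredT (fun p q => z p \in t q)).
by apply: eq_bigr => i _; rewrite cardsE.
Qed.

Definition loopfree : {set {perm T}} := avoiding (cellrel loops) [::].

Lemma loopfreeP (s : {perm T}) : (s \in loopfree) = [forall e, z (s e) \notin t e].
Proof. by rewrite inE andbT avoids_cellrel; apply: eq_forallb => e; rewrite inE. Qed.

(** Here [q = 1 / m] and [D = Dl^2]; as [N <= m * Dl], the error
    [9 * N * q * 44 * D / m] is at most [396 * Dl^3 / m]. *)
Lemma count_loopfree (R : realType) (N : nat) : 0 < Dl -> 400 * (Dl * Dl) <= m -> #|loops| =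
  N ->
  exists err : R, (`|err| <= 396 * (Dl%:R ^+ 3 / m%:R) /\
    #|loopfree|%:R = (m`!)%:R * expR (- (N%:R / m%:R) + err))%R.
Proof.
move=> D0 hM eN.
have DD0 : 0 < Dl * Dl by rewrite muln_gt0 D0.
have hT : 400 * (Dl * Dl) <= #|T| by rewrite card_ord.
have [err [e1 e2]] := count_avoiding_cells R (sparse_loops D0) DD0 hT.
move: e1 e2; rewrite card_ord eN => e1 e2.
exists err; split=> //.
have m0 : (0 < m%:R :> R)%R by rewrite ltr0n; apply: leq_trans hM; rewrite muln_gt0.
apply: le_trans e1 _.
have NB : (N%:R <= m%:R * Dl%:R :> R)%R.
  rewrite -natrM ler_nat -eN card_loops.
  apply: (@leq_trans (\sum_v #|[set i | z i == v]| * Dl)).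
    by apply: leq_sum => v _; rewrite leq_mul2l tdeg orbT.
  by rewrite -(sum_by_fibre z (fun _ => Dl)) sum_nat_const card_ord.
have -> : (9 * N%:R * m%:R^-1 * (44 * (Dl * Dl)%:R / m%:R)
   = 396 * Dl%:R ^+ 2 / m%:R * (N%:R / m%:R) :> R)%R.
  by rewrite natrM; field; rewrite gt_eqF.
have -> : (396 * (Dl%:R ^+ 3 / m%:R) = 396 * Dl%:R ^+ 2 / m%:R * Dl%:R :> R)%R.
  by field; rewrite gt_eqF.
apply: ler_wpM2l; first by rewrite !mulr_ge0 // invr_ge0 ltW.
by rewrite ler_pdivrMr // mulrC.
Qed.

(** Two hyperarcs share their head only if they receive two in-points of a
    common vertex, that is, one of at most [m * Dl] pairs of prescribed cells. *)
Lemma loopfree_repeat e f : 0 < Dl -> 400 * (Dl * Dl) <= m -> e != f ->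
  #|[set s in loopfree | z (s e) == z (s f)]| * m <= 4 * Dl * #|loopfree|.
Proof.
move=> D0 hM ef; set X := [set s in loopfree | _].
have sp := sparse_loops D0.
pose A := [set p : T * T | xpredT p.1 && (z p.1 == z p.2)].
have sub : X \subset \bigcup_(p in A) avoiding (cellrel loops) ([:: (e, p.1);
  (f, p.2)] ++ [::]).
  apply/subsetP => s; rewrite inE => /andP[ss h].
  apply/bigcupP; exists (s e, s f); first by rewrite inE.
  by move: ss; rewrite !inE /= !eqxx !andbT.
have cA : #|A| <= m * Dl.
  rewrite (card_dep_pair xpredT (fun p q => z p == z q)).
  rewrite -[X in X * Dl]card_ord -sum_nat_const; apply: leq_sum => i _.
  apply: leq_trans (zD (z i)); rewrite -cardsE; apply: subset_leq_card.
  by apply/subsetP => j; rewrite !inE unfold_in eq_sym.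
have h : #|X| * m ^ 2 <= #|A| * (2 ^ 2 * #|loopfree|).
  apply: leq_trans (_ : #|\bigcup_(p in A) avoiding (cellrel loops) ([:: (e, p.1);
    (f, p.2)] ++ [::])| * m ^ 2 <= _).
    by rewrite leq_mul2r subset_leq_card ?orbT.
  apply: card_bigcup_le => p _.
  have := @upper_mul _ (cellrel loops) (Dl * Dl) [::] [:: (e, p.1); (f, p.2)] sp;
    rewrite card_ord; apply=> //.
    by move: hM; nia.
  by rewrite /= inE ef.
have m0 : 0 < m by apply: leq_trans hM; rewrite !muln_gt0 D0.
rewrite -(@leq_pmul2r m) // -mulnA mulnn.
apply: leq_trans h _; apply: leq_trans (leq_mul cA (leqnn _)) _.
by apply: eq_leq; rewrite -[2 ^ 2]/4; ring.
Qed.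

End Heads.

(** * How many pairings describe given tails or heads *)

Section Tails.
Variables (M : nat) (V E : finType) (dp : V -> nat) (k : E -> nat).
Variables (u : 'I_M -> V) (w : 'I_M -> E).
Hypothesis uE : forall v, #|[set i | u i == v]| = dp v.
Hypothesis wE : forall e, #|[set i | w i == e]| = k e.

Definition incidences : {set {ffun E -> {set V}}} :=
  [set t : {ffun E -> {set V}} |
    [forall e, #|t e| == k e] && [forall v, #|[set e | v \in t e]| == dp v]].

Definition incidence_of (s : {perm 'I_M}) : {ffun E -> {set V}} :=
  [ffun e => u @: [set i | w (s i) == e]].

Lemma sum_k : \sum_e k e = M.
Proof.
rewrite -[RHS]card_ord -sum1_card (sum_by_fibre w (fun _ => 1)).
by apply: eq_bigr => e _; rewrite wE muln1.
Qed.

Lemma card_wfibre (s : {perm 'I_M}) e : #|[set i | w (s i) == e]| = k e.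
Proof.
by rewrite -wE -[RHS](card_perm_preim s); apply: eq_card => i; rewrite !inE.
Qed.

Lemma incidence_of_in s : s \in simple u w -> incidence_of s \in incidences.
Proof.
move=> /simpleP inj; rewrite inE; apply/andP; split; apply/forallP => x; apply/eqP.
  rewrite ffunE card_in_imset ?card_wfibre // => i i'; rewrite !inE => /eqP e /eqP e' ue.
  by apply: inj; rewrite e e' ue.
rewrite -uE -[RHS](card_in_imset (f := fun i => w (s i))); last first.
  by move=> i i'; rewrite !inE => /eqP e /eqP e' ue; apply: inj; rewrite e e' ue.
apply: eq_card => e; rewrite inE ffunE; apply/imsetP/imsetP => -[i + ->].
  by rewrite inE => /eqP <-; exists i; rewrite ?inE.
by rewrite inE => /eqP <-; exists i; rewrite ?inE.
Qed.

(** Split the choice of [s] according to [W = w \o s], the hyperarc to which each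
    vertex point goes.  The points at [v] are distributed bijectively over the
    hyperarcs meeting [v], which gives [(dp v)`!] choices for each [v]; given [W],
    the points of [e] are matched in [(k e)`!] ways. *)
Lemma card_simple_fibre t : t \in incidences ->
  #|[set s in simple u w | incidence_of s == t]| = (\prod_v (dp v)`!) * (\prod_e (k e)`!).
Proof.
rewrite inE => /andP[/forallP tk /forallP td].
pose B := [set W : {ffun 'I_M -> E} |
  injectiveb [ffun i => (u i, W i)] && [forall i, u i \in t (W i)]].
have Bk W : W \in B -> forall e, #|[set i | W i == e]| = k e.
  rewrite inE => /andP[/injectiveP inj /forallP ut]; apply: eq_from_sum.
    move=> e; rewrite -(eqP (tk e)) -(card_in_imset (f := u)).
      apply: subset_leq_card; apply/subsetP => v /imsetP[i]; rewrite inE => /eqP <- ->.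
      exact: ut.
    move=> i i'; rewrite !inE => /eqP e1 /eqP e2 e3; apply: inj.
    by rewrite !ffunE e1 e2 e3.
  rewrite sum_k -[RHS]card_ord -sum1_card (sum_by_fibre W (fun _ => 1)).
  by apply: eq_bigr => e _; rewrite muln1.
rewrite (@card_fibres _ _ _ B (fun s : {perm 'I_M} => [ffun i => w (s i)]) (\prod_e (k e)`!)).
- congr (_ * _).
  pose f (x : V * E) := if x.1 \in t x.2 then Some x.1 else None.
  pose c i : option V := Some (u i).
  pose g (W : {ffun 'I_M -> E}) := [ffun i => (u i, W i)].
  have gI : injective g.
    by move=> W W' /ffunP e; apply/ffunP => i; have := e i; rewrite !ffunE => -[].
  rewrite -(card_imset B gI).
  have SI : injective (@Some V) by move=> ? ? [].
  have := @card_lifts _ _ f (map Some (enum V)) M c.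
  rewrite map_inj_uniq // enum_uniq => /(_ isT) h.
  have {}h := h (fun i => map_f _ (mem_enum V (u i))).
  rewrite big_map big_enum /= in h.
  rewrite -(eq_bigr _ (fun v _ => ffactnn (dp v))).
  transitivity (\prod_v #|[set x | f x == Some v]| ^_ #|[set i | c i == Some v]|); last first.
    apply: eq_bigr => v _; congr (_ ^_ _).
      rewrite -(eqP (td v)) -(card_imset (f := fun e => (v, e)) [set e | v \in t e]);
        last by move=> ? ? [].
      apply: eq_card => -[v' e]; rewrite inE /f /=; apply/idP/imsetP => [|[e' + [-> ->]]].
        by case: ifP => // ve /eqP[<-]; exists e; rewrite ?inE.
      by rewrite inE => ->.
    by rewrite -uE; apply: eq_card => i; rewrite !inE.
  rewrite -h; apply: eq_card => H; rewrite [RHS]inE; apply/imsetP/andP.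
    move=> [W + ->]; rewrite inE => /andP[inj /forallP ut]; split=> //.
    by apply/forallP => i; rewrite ffunE /f /= ut.
  move=> [/injectiveP inj /forallP fH].
  have Hi i : H i = (u i, (H i).2) /\ u i \in t (H i).2.
    have := fH i; rewrite /f /c; case: ifP => // h1 /eqP[h2]; rewrite -h2.
    by rewrite h2 -h2 -surjective_pairing h2 -h2.
  exists [ffun i => (H i).2].
    rewrite inE; apply/andP; split.
      by apply/injectiveP => i i'; rewrite !ffunE -!(proj1 (Hi _)); exact: inj.
    by apply/forallP => i; rewrite ffunE; case: (Hi i).
  by apply/ffunP => i; rewrite !ffunE -(proj1 (Hi i)).
- move=> s; rewrite inE => /andP[/simpleP inj /eqP et]; rewrite inE -et; apply/andP; split.
    by apply/injectiveP => i i'; rewrite !ffunE; apply: inj.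
  by apply/forallP => i; rewrite !ffunE; apply/imsetP; exists i; rewrite ?inE.
- move=> W WB.
  have := @card_perm_lifts _ M w W (enum E) (enum_uniq E) (fun i => mem_enum E (W i)).
  rewrite big_enum /= => h.
  transitivity (\prod_e (#|[set i | W i == e]|)`!); last by apply: eq_bigr => e _; rewrite Bk.
  rewrite -h; last by move=> e _; rewrite wE Bk.
  apply: eq_card => s; rewrite inE [RHS]inE; apply/andP/forallP.
    by move=> [_ /eqP /ffunP e] i; rewrite -e ffunE.
  move=> e; have eW : [ffun i => w (s i)] = W by apply/ffunP => i; rewrite ffunE; apply/eqP.
  split; last by apply/eqP.
  move: (WB); rewrite inE => /andP[/injectiveP inj /forallP ut].
  rewrite inE; apply/andP; split.
    by apply/simpleP => i i' e1; apply: inj; rewrite !ffunE -(eqP (e i)) -(eqP (e i')).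
  apply/eqP/ffunP => a; rewrite ffunE; apply/eqP; rewrite eqEcard; apply/andP; split.
    by apply/subsetP => v /imsetP[i]; rewrite inE (eqP (e i)) => /eqP <- ->; exact: ut.
  rewrite (eqP (tk a)) card_in_imset ?card_wfibre // => i i'.
  rewrite !inE => /eqP h1 /eqP h2 h3; apply: inj.
  by rewrite !ffunE -(eqP (e i)) -(eqP (e i')) h1 h2 h3.
Qed.

Lemma card_simple (Q : pred {ffun E -> {set V}}) :
  #|[set s in simple u w | Q (incidence_of s)]|
  = #|[set t in incidences | Q t]| * ((\prod_v (dp v)`!) * (\prod_e (k e)`!)).
Proof.
apply: (card_fibres (phi := incidence_of)).
  by move=> s; rewrite inE => /andP[h Qs]; rewrite inE incidence_of_in.
move=> t; rewrite inE => /andP[tI Qt]; rewrite -(card_simple_fibre tI).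
apply: eq_card => s; rewrite inE [LHS]andbC inE [RHS]inE [RHS]andbC.
by case: eqP => [->|] //=; rewrite Qt andbT.
Qed.

End Tails.

Section HeadCount.
Variables (m : nat) (V : finType) (dm : V -> nat) (z : 'I_m -> V).
Hypothesis zE : forall v, #|[set i | z i == v]| = dm v.

Definition assignments : {set {ffun 'I_m -> V}} :=
  [set h : {ffun 'I_m -> V} | [forall v, #|[set e | h e == v]| == dm v]].

Lemma card_assignments (Q : pred {ffun 'I_m -> V}) :
  #|[set s : {perm 'I_m} | Q [ffun e => z (s e)]]|
  = #|[set h in assignments | Q h]| * \prod_v (dm v)`!.
Proof.
apply: (card_fibres (phi := fun s : {perm 'I_m} => [ffun e => z (s e)])).
  move=> s; rewrite !inE => ->; rewrite andbT; apply/forallP => v; apply/eqP.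
  by rewrite -zE -[RHS](card_perm_preim s); apply: eq_card => i; rewrite !inE ffunE.
move=> h; rewrite !inE => /andP[/forallP hd Qh].
have := @card_perm_lifts _ m z h (enum V) (enum_uniq V) (fun i => mem_enum V (h i)).
rewrite big_enum /= => hh.
transitivity (\prod_v (#|[set i | h i == v]|)`!);
  last by apply: eq_bigr => e _; rewrite (eqP (hd e)).
rewrite -hh; last by move=> v _; rewrite zE (eqP (hd v)).
apply: eq_card => s; rewrite !inE; apply/andP/forallP.
  by move=> [_ /eqP /ffunP e] i; rewrite -e ffunE.
move=> e; have eW : [ffun i => z (s i)] = h by apply/ffunP => i; rewrite ffunE; apply/eqP.
by rewrite eW Qh eqxx.
Qed.

End HeadCount.

(** * Labelled directed hypergraphs with singleton heads *)

Section Core.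
Variables (n m M : nat) (dp dm : 'I_n -> nat) (k : 'I_m -> nat) (Dl : nat).
Local Notation V := 'I_n.
Local Notation E := 'I_m.

(** The hyperarc labelled [e] has tail [x.1 e] and head the single vertex
    [x.2 e]: this encodes the labelled hypergraphs of case (a). *)
Definition labelled_dirhyp : {set {ffun E -> {set V}} * {ffun E -> V}} :=
  [set x | (x.1 \in incidences dp k) &&
    [&& x.2 \in assignments m dm, [forall e, x.2 e \notin x.1 e] &
        injectiveb (fun e => (x.1 e, x.2 e))]].

Definition loopless (t : {ffun E -> {set V}}) : {set {ffun E -> V}} :=
  [set h in assignments m dm | [forall e, h e \notin t e]].

Definition coincide (t : {ffun E -> {set V}}) (p : E * E) : {set {ffun E -> V}} :=
  [set h in loopless t | h p.1 == h p.2].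

Definition completions (t : {ffun E -> {set V}}) : {set {ffun E -> V}} :=
  [set h in loopless t | injectiveb (fun e => (t e, h e))].

Lemma card_labelled : #|labelled_dirhyp| = \sum_(t in incidences dp k) #|completions t|.
Proof.
rewrite -(card_dep_pair (fun t => t \in incidences dp k) (fun t h => h \in completions t)).
apply: eq_card => -[t h]; rewrite in_set [RHS]in_set /=; congr (_ && _).
by rewrite !in_set andbA.
Qed.

Lemma labelled_le : #|labelled_dirhyp| <= \sum_(t in incidences dp k) #|loopless t|.
Proof.
rewrite card_labelled; apply: leq_sum => t _; apply: subset_leq_card.
by apply/subsetP => h; rewrite in_set => /andP[].
Qed.

(** A loopless head family that is not counted makes two hyperarcs coincide. *)
Lemma labelled_ge :
  \sum_(t in incidences dp k) #|loopless t| <= #|labelled_dirhyp| +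
   \sum_(p : E * E | p.1 != p.2) \sum_(t in incidences dp k | t p.1 == t p.2) #|coincide t p|.
Proof.
rewrite card_labelled.
rewrite [X in _ <= _ + X](exchange_big_dep (fun t => t \in incidences dp k)) /=;
  last by move=> p t _ /andP[].
rewrite -big_split /=; apply: leq_sum => t tI.
apply: (@leq_trans #|completions t :|:
  \bigcup_(p : E * E | (p.1 != p.2) && (t p.1 == t p.2)) coincide t p|).
  apply: subset_leq_card; apply/subsetP => h hL; rewrite in_setU.
  have [//|nG] := boolP (h \in completions t); apply/bigcupP.
  have : ~~ injectiveb (fun e => (t e, h e)) by move: nG; rewrite in_set hL.
  move=> /injectivePn[e [f ef [te he]]]; exists (e, f); first by rewrite /= ef te eqxx.
  by rewrite in_set hL /= he.
apply: leq_trans (leq_card_setU _ _) _; rewrite leq_add2l.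
rewrite (leq_trans (leq_card_bigcup _ _)) //.
by rewrite leq_eqVlt; apply/orP; left; apply/eqP/eq_bigl => p; rewrite tI.
Qed.

Hypothesis dpM : \sum_v dp v = M.
Hypothesis dmm : \sum_v dm v = m.
Hypothesis kM : \sum_e k e = M.
Hypothesis dpD : forall v, dp v <= Dl.
Hypothesis dmD : forall v, dm v <= Dl.
Hypothesis kD : forall e, k e <= Dl.
Hypothesis k2 : forall e, 1 < k e.

Lemma card_incidences (R : realType) : 0 < Dl -> 400 * (Dl * Dl) <= M ->
  exists err : R, (`|err| <= 198 * (Dl%:R ^+ 4 / M%:R) /\
    #|incidences dp k|%:R * ((\prod_v (dp v)`!) * (\prod_e (k e)`!))%N%:R
     = (M`!)%:R * expR (err
         - (\sum_v (dp v) ^_ 2)%N%:R * (\sum_e (k e) ^_ 2)%N%:R / (2 * M%:R ^+ 2)))%R.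
Proof.
move=> D0 hM.
have [u uE] := exists_labelling dpM; have [w wE] := exists_labelling kM.
have uD v : #|[set i | u i == v]| <= Dl by rewrite uE.
have wD e : #|[set i | w i == e]| <= Dl by rewrite wE.
have [err [e1 e2]] := count_simple uD wD R D0 hM.
exists err; split=> //.
have /= := card_simple uE wE xpredT; rewrite !setIdT.
move=> e; rewrite -natrM -e e2 [X in expR X]addrC.
by under eq_bigr do rewrite uE; under [X in (_ * X%:R / _)%R]eq_bigr do rewrite wE.
Qed.

(** Two points of [e] suffice to make the event improbable; this is where tails
    of size at least 2 are used. *)
Lemma incidence_repeat (e f : E) : 0 < Dl -> 400 * (Dl * Dl) <= M -> e != f ->
  #|[set t in incidences dp k | t e == t f]| * M ^ 2
  <= 16 * Dl ^ 2 * (k f) ^ 2 * #|incidences dp k|.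
Proof.
move=> D0 hM ef.
have [u uE] := exists_labelling dpM; have [w wE] := exists_labelling kM.
have uD v : #|[set i | u i == v]| <= Dl by rewrite uE.
have wD e' : #|[set i | w i == e']| <= Dl by rewrite wE.
have : 1 < #|[set i | w i == e]| by rewrite wE.
move=> /card_gt1P[x1 [x2]]; rewrite !inE => -[/eqP w1 /eqP w2 x12].
set K := (\prod_v (dp v)`!) * (\prod_e (k e)`!).
have K0 : 0 < K by rewrite muln_gt0 !prodn_gt0 // => ?; exact: fact_gt0.
have /= := card_simple uE wE xpredT; rewrite !setIdT => c1.
have c2 := card_simple uE wE (fun t => t e == t f).
rewrite -(@leq_pmul2r K) // -[leqRHS]mulnA -c1 mulnAC -c2.
have wf : w x1 != f by rewrite w1.
have := @simple_repeat _ _ _ u w Dl uD wD x1 x2 f D0 hM x12 _ wf.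
rewrite wE => h; apply: leq_trans (h _); last by rewrite w1 w2.
rewrite leq_mul2r; apply/orP; right; apply: subset_leq_card; apply/subsetP => s.
rewrite !in_set => /andP[-> /eqP/setP Es] /=.
have key x : w x = e -> [exists y, (u y == u ((s^-1)%g x)) && (w (s y) == f)].
  move=> wx; have := Es (u ((s^-1)%g x)); rewrite !ffunE.
  rewrite imset_f; last by rewrite inE permKV wx.
  move=> /esym /imsetP[y]; rewrite inE => h1 h2; apply/existsP; exists y.
  by rewrite h2 eqxx.
by rewrite !key.
Qed.

Lemma incidences_le t : t \in incidences dp k ->
  (forall e, #|t e| <= Dl) /\ (forall v, #|[set e | v \in t e]| = dp v).
Proof.
rewrite inE => /andP[/forallP h1 /forallP h2]; split=> x; last exact/eqP.
by rewrite (eqP (h1 x)).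
Qed.

Lemma loopless_loopfree (z : E -> V) (t : {ffun E -> {set V}}) (Q : pred {ffun E -> V}) :
  (forall v, #|[set i | z i == v]| = dm v) ->
  #|[set s in loopfree z t | Q [ffun e => z (s e)]]|
    = #|[set h in loopless t | Q h]| * \prod_v (dm v)`!.
Proof.
move=> zE.
have := card_assignments zE (fun h => [forall e, h e \notin t e] && Q h).
rewrite (_ : [set h in assignments m dm | _] = [set h in loopless t | Q h]); last first.
  by apply/setP => h; rewrite !inE andbA.
move=> <-; apply: eq_card => s; rewrite inE loopfreeP [RHS]inE; congr (_ && _).
by apply: eq_forallb => e; rewrite ffunE.
Qed.

Lemma card_loopless (R : realType) t :
  0 < Dl -> 400 * (Dl * Dl) <= m -> t \in incidences dp k ->
  exists err : R, (`|err| <= 396 * (Dl%:R ^+ 3 / m%:R) /\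
    #|loopless t|%:R * (\prod_v (dm v)`!)%N%:R
     = (m`!)%:R * expR (- ((\sum_v dp v * dm v)%N%:R / m%:R) + err))%R.
Proof.
move=> D0 hm tI; have [tD td] := incidences_le tI.
have [z zE] := exists_labelling dmm.
have zD v : #|[set i | z i == v]| <= Dl by rewrite zE.
have tdeg v : #|[set e | v \in t e]| <= Dl by rewrite td.
have eN : #|loops z t| = \sum_v dp v * dm v.
  by rewrite card_loops; apply: eq_bigr => v _; rewrite zE td mulnC.
have [err [e1 e2]] := count_loopfree zD tD tdeg R D0 hm eN.
exists err; split => //; rewrite -e2 -natrM.
have /= := loopless_loopfree t xpredT zE; rewrite !setIdT.
by move=> ->.
Qed.

Lemma loopless_repeat t p : 0 < Dl -> 400 * (Dl * Dl) <= m -> t \in incidences dp k ->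
  p.1 != p.2 -> #|coincide t p| * m <= 4 * Dl * #|loopless t|.
Proof.
move=> D0 hm tI ef; have [tD td] := incidences_le tI.
have [z zE] := exists_labelling dmm.
have zD v : #|[set i | z i == v]| <= Dl by rewrite zE.
have tdeg v : #|[set e | v \in t e]| <= Dl by rewrite td.
have h := loopfree_repeat zD tD tdeg D0 hm ef.
have K0 : 0 < \prod_v (dm v)`! by rewrite prodn_gt0 // => v; exact: fact_gt0.
have /= := loopless_loopfree t xpredT zE; rewrite !setIdT => c1.
have c2 := loopless_loopfree t (fun h => h p.1 == h p.2) zE.
rewrite -(leq_pmul2r K0) -[leqRHS]mulnA -c1 mulnAC -c2.
apply: leq_trans h; rewrite leq_mul2r; apply/orP; right.
by apply: subset_leq_card; apply/subsetP => s; rewrite !in_set !ffunE.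
Qed.

End Core.

Section Assembly.
Variable R : realType.
Local Open Scope ring_scope.

Lemma norm_exp_bounds (x e : R) : `|e| <= x -> expR (- x) <= expR e /\ expR e <= expR x.
Proof. by rewrite ler_norml !ler_expR => /andP[]. Qed.

(** Turns the two-sided estimate, with a small subtracted fraction [y], into a
    single exponential error factor. *)
Lemma squeeze_exp (N P x y : R) : 0 <= x -> x <= 1/4 -> 0 < P -> 6 * y <= x ->
  N <= P * expR x -> P * expR (- x) <= N + P * expR x * y ->
  exists err : R, `|err| <= 4 * x /\ N = P * expR err.
Proof.
move=> x0 x1 P0 yx up lo.
have ex : expR x <= 2.
  have h : 1 - x <= expR (- x) by apply: le_trans (expR_ge1Dx _).
  rewrite -[x]opprK expRN -div1r ler_pdivrMr ?expR_gt0 //; lra.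
have lo' : P * expR (- (4 * x)) <= N.
  have h1 : expR (- x) >= 1 - x by apply: le_trans (expR_ge1Dx _).
  have h2 : expR (- (4 * x)) <= 1 - 2 * x.
    apply: le_trans (expR_le_1B _ _); [|lra|lra].
    by rewrite ler_expR lerN2; nra.
  have h3 : expR x * y <= x.
    have [y0|y0] := lerP 0 y; first by apply: (@le_trans _ _ (2 * y)); [exact: ler_wpM2r|lra].
    by apply: (@le_trans _ _ 0) => //; rewrite nmulr_lle0 // expR_ge0.
  have h4 : P * (expR x * y) <= P * x by rewrite ler_pM2l.
  have h5 : P * (1 - x) <= P * expR (- x) by rewrite ler_pM2l.
  have h6 : P * expR (- (4 * x)) <= P * (1 - 2 * x) by rewrite ler_pM2l.
  rewrite mulrA in h4; lra.
have N0 : 0 < N by apply: lt_le_trans lo'; rewrite mulr_gt0 ?expR_gt0.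
exists (ln (N / P)); split; last first.
  by rewrite lnK ?posrE ?divr_gt0 // mulrC divfK // gt_eqF.
rewrite ler_norml; apply/andP; split.
  by rewrite -ler_expR lnK ?posrE ?divr_gt0 // ler_pdivlMr // mulrC.
rewrite -ler_expR lnK ?posrE ?divr_gt0 // ler_pdivrMr // mulrC.
by apply: le_trans up _; rewrite ler_pM2l // ler_expR; lra.
Qed.

(** Multiply the count of tail families by the uniform count of loopless heads.
    For coinciding hyperarcs, summing the product of the bounds of
    [incidence_repeat] and [loopless_repeat] over [(e, f)] gives the fraction
    [64 * Dl^3 * (\sum_f k_f^2) / M^2 <= 64 * g].  The bound [M <= m * Dl] turns
    [Dl^3 / m] into [Dl^4 / M]. *)
Lemma count_labelled_dirhyp (n m M : nat) (dp dm : 'I_n -> nat) (k : 'I_m -> nat) (Dl : nat) :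
  (\sum_v dp v = M)%N -> (\sum_v dm v = m)%N -> (\sum_e k e = M)%N -> (0 < M)%N ->
  (forall v, dp v <= Dl)%N -> (forall v, dm v <= Dl)%N -> (forall e, k e <= Dl)%N ->
  (forall e, 1 < k e)%N ->
  let g : R := Dl%:R ^+ 4 / M%:R in g < 1 / 2000 ->
  exists err : R, `|err| <= 2000 * g /\
    #|labelled_dirhyp dp dm k|%:R =
     (M`! * m`!)%N%:R / ((\prod_v ((dp v)`! * (dm v)`!)) * (\prod_e (k e)`!))%N%:R
     * expR (- ((\sum_v (dp v) ^_ 2)%N%:R * (\sum_e (k e) ^_ 2)%N%:R / (2 * M%:R ^+ 2))
             - (\sum_v dp v * dm v)%N%:R / m%:R + err).
Proof.
move=> dpM dmm kM M0 dpD dmD kD k2 g gs.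
have Mr : 0 < M%:R :> R by rewrite ltr0n.
have MDm : (M <= m * Dl)%N.
  by rewrite -kM -[m in (m * _)%N]card_ord -sum_nat_const; apply: leq_sum.
have m0 : (0 < m)%N by move: M0 MDm; case: (m) => //; rewrite mul0n; lia.
have D0 : (0 < Dl)%N by move: M0 MDm; case: (Dl) => //; rewrite muln0; lia.
have mr : 0 < m%:R :> R by rewrite ltr0n.
have Dr : 1 <= Dl%:R :> R by rewrite ler1n.
have MDr : M%:R <= m%:R * Dl%:R :> R by rewrite -natrM ler_nat.
have gM : g * M%:R = Dl%:R ^+ 4 by rewrite /g divfK // gt_eqF.
have g0 : 0 <= g by rewrite /g divr_ge0 // exprn_ge0.
have hMr : 2000 * Dl%:R ^+ 4 <= M%:R :> R.
  have : g * M%:R <= (1/2000) * M%:R by rewrite ler_wpM2r // ltW.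
  by rewrite gM; lra.
have hmr : 2000 * Dl%:R ^+ 3 <= m%:R :> R.
  rewrite -(@ler_pM2r _ Dl%:R); last by lra.
  by apply: le_trans MDr; apply: le_trans hMr; rewrite -mulrA -exprSr.
have hM : (400 * (Dl * Dl) <= M)%N.
  rewrite -(ler_nat R) natrM; apply: le_trans hMr.
  by rewrite -natrX -!natrM ler_nat leq_mul // mulnn leq_pexp2l.
have hm : (400 * (Dl * Dl) <= m)%N.
  rewrite -(ler_nat R) natrM; apply: le_trans hmr.
  by rewrite -natrX -!natrM ler_nat leq_mul // mulnn leq_pexp2l.
have D3 : Dl%:R ^+ 3 / m%:R <= g.
  rewrite /g ler_pdivrMr // mulrAC ler_pdivlMr //.
  rewrite [leRHS](_ : _ = Dl%:R ^+ 3 * (m%:R * Dl%:R)); last by ring.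
  by rewrite ler_wpM2l // exprn_ge0.
set K1 := ((\prod_v (dp v)`!) * (\prod_e (k e)`!))%N.
set K2 := (\prod_v (dm v)`!)%N.
have K10 : 0 < K1%:R :> R by rewrite ltr0n muln_gt0 !prodn_gt0 // => ?; exact: fact_gt0.
have K20 : 0 < K2%:R :> R by rewrite ltr0n prodn_gt0 // => ?; exact: fact_gt0.
set I := incidences dp k.
set Rd := (\sum_v dp v * dm v)%N.
(* [396 * g] bounds the error exponent of [card_loopless]. *)
pose x : R := 396 * g.
(* [a] is the main term of the number of loopless head families. *)
pose a : R := (m`!)%:R * expR (- (Rd%:R / m%:R)) / K2%:R.
have a0 : 0 < a by rewrite divr_gt0 // mulr_gt0 ?expR_gt0 // ltr0n fact_gt0.
have [e1 [e1b e1E]] := card_incidences dpM kM dpD kD R D0 hM.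
have I0 : 0 < #|I|%:R :> R.
  rewrite -(@pmulr_lgt0 _ K1%:R) // e1E mulr_gt0 ?expR_gt0 // ltr0n fact_gt0 //.
have lb t : t \in I ->
    a * expR (- x) <= #|loopless dm t|%:R /\ #|loopless dm t|%:R <= a * expR x.
  move=> tI; have [e2 [e2b e2E]] := card_loopless dmm dpD dmD kD R D0 hm tI.
  have e2x : `|e2| <= x by apply: le_trans e2b _; rewrite ler_wpM2l.
  have [h1 h2] := norm_exp_bounds e2x.
  have -> : #|loopless dm t|%:R = a * expR e2 :> R.
    apply: (mulIf (lt0r_neq0 K20)); rewrite e2E -/Rd expRD /a.
    by rewrite [RHS]mulrAC divfK ?gt_eqF // mulrA.
  by rewrite !ler_pM2l.
have up : #|labelled_dirhyp dp dm k|%:R <= (#|I|%:R * a) * expR x.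
  apply: le_trans (_ : (\sum_(t in I) #|loopless dm t|)%N%:R <= _).
    by rewrite ler_nat labelled_le.
  rewrite natr_sum -mulrA mulr_natl -sumr_const; apply: ler_sum => t tI.
  by case: (lb t tI).
have lo : (#|I|%:R * a) * expR (- x) <= #|labelled_dirhyp dp dm k|%:R
     + (#|I|%:R * a) * expR x * (64 * g).
  apply: le_trans (_ : (\sum_(t in I) #|loopless dm t|)%N%:R <= _).
    rewrite natr_sum -mulrA mulr_natl -sumr_const; apply: ler_sum => t tI.
    by case: (lb t tI).
  apply: le_trans (_ : _ <= (#|labelled_dirhyp dp dm k| + _)%N%:R) _.
    rewrite ler_nat; exact: labelled_ge.
  rewrite natrD lerD2l natr_sum.
  (* [b f] bounds the contribution of any pair [(e, f)]. *)
  pose b (f : 'I_m) : R :=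
    16 * Dl%:R ^+ 2 * (k f)%:R ^+ 2 * #|I|%:R / M%:R ^+ 2 *
    (4 * Dl%:R / m%:R * (a * expR x)).
  have b0 f : 0 <= b f.
    by rewrite /b; do ![apply: mulr_ge0 | apply: exprn_ge0 | rewrite invr_ge0];
      rewrite ?expR_ge0 ?(ltW a0) // ?exprn_ge0.
  apply: le_trans (_ : \sum_(p : 'I_m * 'I_m) b p.2 <= _).
    rewrite [leLHS]big_mkcond; apply: ler_sum => p _; case: ifP => // ef.
    rewrite natr_sum.
    apply: le_trans (_ : \sum_(t in [set t in I | t p.1 == t p.2])
      (4 * Dl%:R / m%:R * (a * expR x)) <= _).
      rewrite [leRHS](eq_bigl (fun t => (t \in I) && (t p.1 == t p.2)));
        last by move=> t; rewrite in_set.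
      apply: ler_sum => t /andP[tI _].
      have := loopless_repeat dmm dpD dmD kD D0 hm tI ef.
      rewrite -(ler_nat R) !natrM -ler_pdivlMr // => h; apply: le_trans h _.
      rewrite [leLHS](_ : _ = 4 * Dl%:R / m%:R * #|loopless dm t|%:R); last by ring.
      apply: ler_wpM2l; last by case: (lb t tI).
      by rewrite divr_ge0 // mulr_ge0.
    rewrite sumr_const -[leLHS]mulr_natl /b; apply: ler_wpM2r.
      by rewrite !mulr_ge0 ?expR_ge0 ?invr_ge0 // ltW.
    have := incidence_repeat dpM kM dpD kD k2 D0 hM ef.
    rewrite -(ler_nat R) !natrM -!expr2 -ler_pdivlMr //.
    by rewrite exprn_gt0.
  have -> : \sum_(p : 'I_m * 'I_m) b p.2 = \sum_(e : 'I_m) \sum_(f : 'I_m) b f.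
    by rewrite pair_bigA.
  rewrite sumr_const card_ord -[leLHS]mulr_natl.
  have kk : (\sum_e (k e)%:R ^+ 2 : R) <= Dl%:R * M%:R.
    rewrite -kM natr_sum mulr_sumr; apply: ler_sum => e _.
    by rewrite expr2 ler_wpM2r // ler_nat.
  pose c : R := 16 * Dl%:R ^+ 2 * #|I|%:R / M%:R ^+ 2 * (4 * Dl%:R / m%:R * (a * expR x)).
  have c0 : 0 <= c.
    by rewrite /c; do ![apply: mulr_ge0 | apply: exprn_ge0 | rewrite invr_ge0];
      rewrite ?expR_ge0 ?(ltW a0) // ?exprn_ge0.
  have -> : \sum_f b f = c * \sum_e (k e)%:R ^+ 2.
    by rewrite mulr_sumr; apply: eq_bigr => f _; rewrite /b /c; ring.
  apply: le_trans (_ : m%:R * (c * (Dl%:R * M%:R)) <= _).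
    by rewrite ler_wpM2l // ler_wpM2l.
  rewrite le_eqVlt; apply/orP; left; apply/eqP.
  by rewrite /c /g; field; rewrite !gt_eqF.
have [||||e3 [e3b e3E]] := @squeeze_exp _ (#|I|%:R * a) x (64 * g) _ _ _ _ up lo.
- by rewrite /x mulr_ge0.
- by rewrite /x; lra.
- by rewrite mulr_gt0.
- by rewrite /x; lra.
(* The error exponent is at most [(198 + 4 * 396) * g]. *)
exists (e1 + e3); split.
  apply: le_trans (ler_normD _ _) _.
  have : `|e1| <= 198 * g := e1b.
  by move: e3b; rewrite /x; lra.
rewrite e3E.
have -> : #|I|%:R = (M`!)%:R * expR (e1
    - (\sum_v (dp v) ^_ 2)%N%:R * (\sum_e (k e) ^_ 2)%N%:R / (2 * M%:R ^+ 2)) / K1%:R :> R.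
  by rewrite -e1E mulfK // gt_eqF.
have -> : ((\prod_v ((dp v)`! * (dm v)`!)) * (\prod_e (k e)`!) = K1 * K2)%N.
  by rewrite big_split /= /K1 /K2 mulnAC.
rewrite [(M`! * _)%N%:R]natrM [(K1 * K2)%N%:R]natrM /a.
set A := (M`!)%:R; set B := (m`!)%:R.
rewrite !expRD; field.
by rewrite !gt_eqF // K10 K20.
Qed.

End Assembly.

(** * Forgetting the labels *)

Section Arrangements.
Variables (n N : nat).
Local Notation arc := ({set 'I_n} * {set 'I_n})%type.

(** Hypergraphs with labelled hyperarcs.  A labelling is a bijection from ['I_N]
    to the hyperarcs that respects the prescribed types [ty]. *)
Definition arrangements (dp dm : 'I_n -> nat) (ty : 'I_N -> nat * nat) :
    {set {ffun 'I_N -> arc}} :=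
  [set h : {ffun 'I_N -> arc} | [&& injectiveb h,
    [forall e, hyperarc (h e) && ((#|tail (h e)|, #|Defs.head (h e)|) == ty e)],
    [forall v, #|[set e | v \in tail (h e)]| == dp v] &
    [forall v, #|[set e | v \in Defs.head (h e)]| == dm v]]].

Definition reverse (e : arc) : arc := (e.2, e.1).

Lemma arrangements_reverse dp dm ty :
  #|arrangements dp dm ty| = #|arrangements dm dp (fun e => ((ty e).2, (ty e).1))|.
Proof.
pose r (h : {ffun 'I_N -> arc}) := [ffun e => reverse (h e)].
have rK : involutive r by move=> h; apply/ffunP => e; rewrite !ffunE; case: (h e).
have sub d1 d2 t h : h \in arrangements d1 d2 t ->
    r h \in arrangements d2 d1 (fun e => ((t e).2, (t e).1)).
  rewrite !inE => /and4P[/injectiveP hI /forallP h1 /forallP h2 /forallP h3].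
  apply/and4P; split.
  - by apply/injectiveP => e f; rewrite !ffunE => -[e1 e2]; apply: hI;
      case: (h e) (h f) e1 e2 => ? ? [? ?] /= -> ->.
  - apply/forallP => e; rewrite ffunE; have /andP[/and3P[a1 a2 a3] /eqP a4] := h1 e.
    rewrite /hyperarc /tail /Defs.head /= a1 disjoint_sym a3 andbT.
    by rewrite -/(Defs.head (h e)) a2 -a4 eqxx.
  - apply/forallP => v; rewrite -(eqP (h3 v)); apply/eqP/eq_card => e.
    by rewrite !inE ffunE.
  - apply/forallP => v; rewrite -(eqP (h2 v)); apply/eqP/eq_card => e.
    by rewrite !inE ffunE.
rewrite -(card_imset (arrangements dp dm ty) (inv_inj rK)); apply: eq_card => h.
apply/imsetP/idP => [[h' h'A ->]|hA]; first exact: sub.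
exists (r h); last by rewrite rK.
by have := sub _ _ _ _ hA; congr (_ \in _); congr arrangements; apply/funext => e /=;
  case: (ty e).
Qed.

(** A head of size 1 is the same thing as a vertex. *)
Lemma card_arrangements (dp dm : 'I_n -> nat) (ty : 'I_N -> nat * nat) :
  (forall e, (ty e).2 = 1) -> (forall e, 0 < (ty e).1) ->
  #|arrangements dp dm ty| = #|labelled_dirhyp dp dm (fun e => (ty e).1)|.
Proof.
move=> ty2 ty1.
pose g (x : {ffun 'I_N -> {set 'I_n}} * {ffun 'I_N -> 'I_n}) : {ffun 'I_N -> arc} :=
  [ffun e => (x.1 e, [set x.2 e])].
have gI : injective g.
  move=> [t h] [t' h'] /ffunP e; congr pair; apply/ffunP => a; have := e a;
    rewrite !ffunE => -[] //=.
  by move=> _ /set1_inj.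
rewrite -[RHS](card_imset _ gI); apply: eq_card => H; apply/idP/imsetP.
  rewrite inE => /and4P[/injectiveP HI /forallP h1 /forallP h2 /forallP h3].
  have ex e : exists v, (H e).2 = [set v].
    have /andP[_] := h1 e; rewrite /tail /Defs.head [ty e]surjective_pairing ty2.
    by move=> /eqP[_ /eqP] /cards1P.
  have [h hE] := fin_all_exists ex.
  have Hg : H = g ([ffun e => (H e).1], [ffun e => h e]).
    by apply/ffunP => e; rewrite !ffunE /= -hE -surjective_pairing.
  exists ([ffun e => (H e).1], [ffun e => h e]) => //.
  rewrite in_set /=; apply/andP; split; [|apply/and3P; split].
  - rewrite in_set; apply/andP; split; apply/forallP => a.
      rewrite ffunE; have /andP[_] := h1 a; rewrite /tail.
      by rewrite [ty a]surjective_pairing => /eqP[-> _].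
    by rewrite -(eqP (h2 a)); apply/eqP/eq_card => e; rewrite !inE ffunE.
  - rewrite in_set; apply/forallP => a.
    by rewrite -(eqP (h3 a)); apply/eqP/eq_card => e;
      rewrite !inE ffunE /Defs.head hE inE eq_sym.
  - apply/forallP => e; rewrite !ffunE; have /andP[/and3P[_ _]] := h1 e.
    by rewrite /tail /Defs.head hE disjoint_sym disjoints1.
  - apply/injectiveP => e f; rewrite !ffunE => -[e1 e2]; apply: HI.
    by rewrite [H e]surjective_pairing [H f]surjective_pairing !hE e1 e2.
move=> [[t h] + ->]; rewrite in_set /= => /and4P[tI hA /forallP lf /injectiveP inj].
move: tI hA; rewrite !in_set => /andP[/forallP tk /forallP td] /forallP hd.
apply/and4P; split.
- apply/injectiveP => e f; rewrite !ffunE => -[e1 /set1_inj e2]; apply: inj.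
  by rewrite e1 e2.
- apply/forallP => e; rewrite ffunE /hyperarc /tail /Defs.head /=.
  rewrite -card_gt0 (eqP (tk e)) ty1 /= disjoint_sym disjoints1 lf.
  rewrite -card_gt0 cards1 /=; apply/eqP; by rewrite [RHS]surjective_pairing ty2.
- apply/forallP => v; rewrite -(eqP (td v)); apply/eqP/eq_card => e; by rewrite !inE ffunE.
- apply/forallP => v; rewrite -(eqP (hd v)); apply/eqP/eq_card => e.
  by rewrite !inE ffunE /Defs.head inE eq_sym.
Qed.

Definition arc_type (e : arc) : nat * nat := (#|tail e|, #|Defs.head e|).

Lemma card_imset_filter (S X : finType) (h : S -> X) (P : pred X) :
  injective h -> #|[set e in h @: setT | P e]| = #|[set i | P (h i)]|.
Proof.
move=> hI; rewrite -(card_imset [set i | P (h i)] hI); apply: eq_card => e.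
rewrite in_set; apply/andP/imsetP => [[/imsetP[i _ ->] Pi]|[i + ->]].
  by exists i; rewrite ?inE.
by rewrite inE => Pi; split=> //; apply: imset_f.
Qed.

(** Forgetting the labels identifies the arrangements that differ by permuting
    hyperarcs of equal type. *)
Lemma card_dirhyp (dp dm : n.-tuple nat) (sigma : typefun) (ty : 'I_N -> nat * nat) :
  (forall a : posnat * posnat, #|[set e | ty e == (val a.1, val a.2)]| = sigma a) ->
  (forall e, exists2 a, a \in finsupp sigma & ty e = (val a.1, val a.2)) ->
  #|arrangements (tnth dp) (tnth dm) ty| =
   num_dirhyp dp dm sigma * \prod_(a <- finsupp sigma) (sigma a)`!.
Proof.
move=> tyc tya.
apply: (card_fibres (phi := fun h : {ffun 'I_N -> arc} => h @: setT)).
  move=> h; rewrite inE => /and4P[/injectiveP hI /forallP h1 /forallP h2 /forallP h3].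
  rewrite inE; apply/asboolP; split.
  - by move=> e /imsetP[i _ ->]; case/andP: (h1 i).
  - by move=> v; rewrite /outdeg (card_imset_filter (fun e => v \in tail e) hI); apply/eqP.
  - by move=> v; rewrite /indeg (card_imset_filter (fun e => v \in Defs.head e) hI); apply/eqP.
  - move=> a; rewrite (card_imset_filter
      (fun e => (#|tail e| == val a.1) && (#|Defs.head e| == val a.2)) hI).
    by rewrite -tyc; apply: eq_card => i; rewrite !inE; have /andP[_ /eqP <-] := h1 i.
move=> E; rewrite inE => /asboolP[hE oE iE tE].
pose f (e : arc) := if e \in E then Some (arc_type e) else None.
pose key (a : posnat * posnat) := Some (val a.1, val a.2).
have keyI : injective key by move=> [a b] [a' b'] [/val_inj -> /val_inj ->].
have uk : uniq (map key (finsupp sigma)) by rewrite map_inj_uniq // fset_uniq.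
have ck i : Some (ty i) \in map key (finsupp sigma).
  by have [a aS ->] := tya i; apply: map_f.
have := card_lifts f uk ck; rewrite big_map /=.
have -> : \prod_(a <- finsupp sigma)
    #|[set x | f x == key a]| ^_ #|[set i | Some (ty i) == key a]|
   = \prod_(a <- finsupp sigma) (sigma a)`!.
  apply: eq_bigr => a _; rewrite -ffactnn; congr (_ ^_ _).
    rewrite -tE; apply: eq_card => e; rewrite !inE /f /key; case: ifP => //.
  by rewrite -tyc; apply: eq_card => i; rewrite !inE.
move=> <-; apply: eq_card => h; rewrite in_set [RHS]in_set; apply/andP/andP.
  rewrite in_set => -[/and4P[hI /forallP h1 _ _] /eqP hIm]; split=> //.
  apply/forallP => i; have /andP[_ /eqP <-] := h1 i.
  by rewrite /f -hIm imset_f // /arc_type.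
move=> [/injectiveP hI /forallP fh].
have hi i : h i \in E /\ arc_type (h i) = ty i.
  by have := fh i; rewrite /f; case: ifP => // hiE /eqP[].
have im : h @: setT = E.
  apply/eqP; rewrite eqEsubset; apply/andP; split.
    by apply/subsetP => _ /imsetP[i _ ->]; case: (hi i).
  apply/subsetP => e eE; have /and3P[t0 h0 _] := hE e eE.
  rewrite -card_gt0 in t0; rewrite -card_gt0 in h0.
  pose a : posnat * posnat := (exist _ #|tail e| t0, exist _ #|Defs.head e| h0).
  have sub : h @: [set i | ty i == (val a.1, val a.2)] \subset
    [set e in E | (#|tail e| == val a.1) && (#|Defs.head e| == val a.2)].
    apply/subsetP => _ /imsetP[i + ->]; rewrite !in_set; have [-> <-] := hi i.
    by [].
  have ec : #|h @: [set i | ty i == (val a.1, val a.2)]| =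
     #|[set e in E | (#|tail e| == val a.1) && (#|Defs.head e| == val a.2)]|.
    by rewrite card_imset // tyc tE.
  have := subset_cardP ec sub e.
  rewrite [in RHS]in_set eE /= !eqxx => /imsetP[i _ ->]; exact: imset_f.
rewrite im eqxx; split=> //; rewrite in_set; apply/and4P; split.
- exact/injectiveP.
- apply/forallP => i; have [hiE <-] := hi i; rewrite /arc_type eqxx andbT; exact: hE.
- apply/forallP => v; apply/eqP; rewrite -oE /outdeg -im.
  by rewrite (card_imset_filter (fun e => v \in tail e) hI).
- apply/forallP => v; apply/eqP; rewrite -iE /indeg -im.
  by rewrite (card_imset_filter (fun e => v \in Defs.head e) hI).
Qed.

End Arrangements.

(** * The list of types, the exponent, and the theorem *)

Section Klist.
Variable sigma : typefun.
Definition type_of (a : posnat * posnat) : nat * nat := (val a.1, val a.2).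

Lemma type_of_inj : injective type_of.
Proof. by move=> [a b] [a' b'] [/val_inj -> /val_inj ->]. Qed.

Lemma sum_klist (G : nat * nat -> nat) :
  \sum_(x <- klist sigma) G x = \sum_(a <- finsupp sigma) sigma a * G (type_of a).
Proof.
rewrite (perm_big _ (permEl (perm_sort _ _))) big_flatten big_map /=.
apply: eq_bigr => a _; rewrite /type_of.
by elim: (sigma a) => [|j IH] /=; rewrite ?big_nil // big_cons IH mulSn.
Qed.

Lemma size_klist : size (klist sigma) = num_arcs sigma.
Proof.
rewrite -sum1_size sum_klist; apply: eq_bigr => a _; exact: muln1.
Qed.

Lemma count_klist a : count_mem (type_of a) (klist sigma) = sigma a.
Proof.
rewrite -sum1_count big_mkcond sum_klist.
under eq_bigr do rewrite /= (inj_eq type_of_inj).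
have [aS|aS] := boolP (a \in finsupp sigma).
  rewrite (bigD1_seq a) ?fset_uniq //= eqxx muln1 big1 ?addn0 // => b ba.
  by rewrite (negbTE ba) muln0.
rewrite big_seq big1; first by rewrite fsfun_dflt.
move=> b bS; case: eqP => [e|_]; last by rewrite muln0.
by move: aS; rewrite -e bS.
Qed.

Lemma mem_klist x : x \in klist sigma -> exists2 a, a \in finsupp sigma & x = type_of a.
Proof.
rewrite mem_sort => /flattenP[s /mapP[a aS ->]].
by rewrite mem_nseq => /andP[_ /eqP ->]; exists a.
Qed.

Lemma kappa_le a : a \in finsupp sigma -> kappa sigma <= val a.1 + val a.2.
Proof.
move=> aS; rewrite /kappa /min_seq; set s := map _ _.
have : val a.1 + val a.2 \in s by apply: map_f.
move: (seq.head 0 s) => x0; elim: s => // y s IH; rewrite inE big_cons geq_min.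
by case/orP => [/eqP ->|/IH ->]; rewrite ?leqnn ?orbT.
Qed.

Lemma card_arrangements_klist n (dp dm : n.-tuple nat) :
  #|arrangements (tnth dp) (tnth dm)
      (fun e : 'I_(num_arcs sigma) => nth (0, 0) (klist sigma) e)|
  = num_dirhyp dp dm sigma * \prod_(a <- finsupp sigma) (sigma a)`!.
Proof.
have szb : size (klist sigma) == num_arcs sigma by rewrite size_klist.
apply: card_dirhyp => [a|e].
  rewrite -count_klist -(card_tnth (Tuple szb) (pred1 (type_of a))).
  by apply: eq_card => e; rewrite !inE (tnth_nth (0, 0)).
by apply: mem_klist; rewrite mem_nth // size_klist.
Qed.

End Klist.

Lemma max_seq_le s x : x \in s -> x <= max_seq s.
Proof. by move=> xs; apply: (@leq_bigmax_seq _ s xpredT id). Qed.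

Lemma ffact_sum_le s D r :
  (forall x, x \in s -> x <= D) -> ffact_sum s r.+1 <= D ^ r * sum_seq s.
Proof.
move=> h; rewrite /ffact_sum /sum_seq big_distrr /=.
rewrite big_seq [leqRHS]big_seq; apply: leq_sum => x /h xD.
elim: r => [|r IH]; first by rewrite ffactn1 expn0 mul1n.
rewrite ffactnSr expnS -mulnA mulnC; apply: leq_mul => //.
exact: leq_trans (leq_subr _ _) xD.
Qed.

Section Final.
Variable R : realType.
Local Open Scope ring_scope.

(** Since [S_r, T_r <= D^(r-1) * S], every other term of [F] is at most a constant
    times [D^4 / S]; the constants add up to less than 3. *)
Lemma F_approx (s t : seq nat) (D : nat) :
  sum_seq s = sum_seq t -> (0 < sum_seq s)%N -> (0 < D)%N ->
  (forall x, x \in s -> x <= D)%N -> (forall x, x \in t -> x <= D)%N ->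
  `|F R s t + (ffact_sum s 2)%:R * (ffact_sum t 2)%:R / (2 * (sum_seq s)%:R ^+ 2)|
    <= 3 * (D%:R ^+ 4 / (sum_seq s)%:R).
Proof.
move=> st s0 D0 sD tD.
have B2 := ffact_sum_le 1 sD; have B3 := ffact_sum_le 2 sD.
have C2 := ffact_sum_le 1 tD; have C3 := ffact_sum_le 2 tD.
rewrite -st in C2 C3; rewrite /F.
move: s0 B2 B3 C2 C3; rewrite -!(ler_nat R) !natrM !natrX expr1.
move: (ffact_sum s 2)%:R (ffact_sum s 3)%:R (ffact_sum t 2)%:R (ffact_sum t 3)%:R
  (ler0n R (ffact_sum s 2)) (ler0n R (ffact_sum s 3))
  (ler0n R (ffact_sum t 2)) (ler0n R (ffact_sum t 3)).
have : 1 <= D%:R :> R by rewrite ler1n.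
move: D%:R (sum_seq s)%:R => d S d1 S2 S3 T2 T3 S20 S30 T20 T30 S1 B2 B3 C2 C3.
have S0 : 0 < S by apply: lt_le_trans S1.
pose a := S2 / S; pose b := T2 / S; pose p := S3 / S; pose q := T3 / S.
have aB : 0 <= a <= d by rewrite /a divr_ge0 ?(ltW S0) //= ler_pdivrMr.
have bB : 0 <= b <= d by rewrite /b divr_ge0 ?(ltW S0) //= ler_pdivrMr.
have pB : 0 <= p <= d ^+ 2 by rewrite /p divr_ge0 ?(ltW S0) //= ler_pdivrMr.
have qB : 0 <= q <= d ^+ 2 by rewrite /q divr_ge0 ?(ltW S0) //= ler_pdivrMr.
set X := _ + _.
have -> : X = (- (a * b / 2) + p * q / 3 - a * b * (a + b) / 4 - (a * a * q + p * (b * b)) / 2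
   + (a * b) * (a * b) / 2) / S.
  by rewrite /X /a /b /p /q; field; rewrite gt_eqF.
rewrite normrM (ger0_norm (_ : 0 <= S^-1)) ?invr_ge0 ?(ltW S0) //.
rewrite [leRHS]mulrA ler_pM2r ?invr_gt0 //.
case/andP: aB => a0 ad; case/andP: bB => b0 bd; case/andP: pB => p0 pd; case/andP: qB => q0 qd.
have d0 : 0 <= d by lra.
have prod_le (x y u v : R) :
    0 <= x -> 0 <= y -> x <= u -> y <= v -> 0 <= x * y /\ x * y <= u * v.
  by move=> x0 y0 xu yv; split; [exact: mulr_ge0|exact: ler_pM].
have [ab0 abd] := prod_le _ _ _ _ a0 b0 ad bd.
have [aa0 aad] := prod_le _ _ _ _ a0 a0 ad ad.
have [bb0 bbd] := prod_le _ _ _ _ b0 b0 bd bd.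
have [pq0 pqd] := prod_le _ _ _ _ p0 q0 pd qd.
have [aaq0 aaqd] := prod_le _ _ _ _ aa0 q0 aad qd.
have [pbb0 pbbd] := prod_le _ _ _ _ p0 bb0 pd bbd.
have [abab0 ababd] := prod_le _ _ _ _ ab0 ab0 abd abd.
have s0 : 0 <= a + b by lra.
have sd : a + b <= 2 * d by lra.
have [abs0 absd] := prod_le _ _ _ _ ab0 s0 abd sd.
have e2 : d * d <= d ^+ 4.
  by rewrite -expr2; apply: ler_weXn2l.
have e3 : d * d * (2 * d) <= 2 * d ^+ 4.
  rewrite (_ : d * d * (2 * d) = 2 * d ^+ 3); last by ring.
  by rewrite ler_pM2l //; apply: ler_weXn2l.
have e4 : d ^+ 2 * d ^+ 2 = d ^+ 4 by ring.
have e4' : d * d * d ^+ 2 = d ^+ 4 by ring.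
have e4'' : d ^+ 2 * (d * d) = d ^+ 4 by ring.
have e4''' : d * d * (d * d) = d ^+ 4 by ring.
rewrite ler_norml; apply/andP; split; lra.
Qed.

Lemma count_seq_form (n N : nat) (d1 d2 : n.-tuple nat) (ks : N.-tuple nat) (Dl : nat) :
  sum_seq d1 = sum_seq ks -> sum_seq d2 = N -> (0 < sum_seq d1)%N ->
  (max_seq d1 <= Dl)%N -> (max_seq d2 <= Dl)%N -> (max_seq ks <= Dl)%N ->
  (forall x, x \in ks -> 1 < x)%N ->
  let g : R := Dl%:R ^+ 4 / (sum_seq d1)%:R in g < 1 / 2000 ->
  exists err : R, `|err| <= 2003 * g /\
    #|labelled_dirhyp (tnth d1) (tnth d2) (tnth ks)|%:R =
     ((sum_seq d1)`! * N`!)%N%:R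
     / ((\prod_(v < n) ((tnth d1 v)`! * (tnth d2 v)`!)) * (\prod_(x <- ks) x`!))%N%:R
     * expR (F R d1 ks - (Rd d1 d2)%:R / N%:R + err).
Proof.
move=> s1 s2 s0 m1 m2 m3 k2 g gs.
have sumT j (t : j.-tuple nat) : (\sum_v tnth t v = sum_seq t)%N by rewrite /sum_seq big_tuple.
have maxT j (t : j.-tuple nat) v : (max_seq t <= Dl)%N -> (tnth t v <= Dl)%N.
  by apply: leq_trans; apply: max_seq_le; exact: mem_tnth.
have D0 : (0 < Dl)%N.
  rewrite lt0n; apply/eqP => D0; move: s0; rewrite -sumT big1 // => v _.
  by apply/eqP; rewrite -leqn0 -D0; apply: maxT.
have [err [e1 e2]] := @count_labelled_dirhyp R n N (sum_seq d1) (tnth d1) (tnth d2) (tnth ks) Dl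
  (sumT _ _) (etrans (sumT _ _) s2) (etrans (sumT _ _) (esym s1)) s0
  (fun v => maxT _ _ v m1) (fun v => maxT _ _ v m2) (fun v => maxT _ _ v m3)
  (fun e => k2 _ (mem_tnth e ks)) gs.
have fa := @F_approx d1 ks Dl s1 s0 D0 (fun x h => leq_trans (max_seq_le h) m1)
   (fun x h => leq_trans (max_seq_le h) m3).
set B := (ffact_sum d1 2)%:R * _ / _ in fa.
exists (err - (F R d1 ks + B)); split.
  by apply: le_trans (ler_normB _ _) _; move: fa e1; rewrite -/g; lra.
rewrite e2 big_tuple; congr (_ * expR _).
have -> : (\sum_v (tnth d1 v) ^_ 2)%N = ffact_sum d1 2 by rewrite /ffact_sum big_tuple.
have -> : (\sum_v (tnth ks v) ^_ 2)%N = ffact_sum ks 2 by rewrite /ffact_sum big_tuple.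
rewrite -/B /Rd; ring.
Qed.

Lemma divide_out (X Y a b c : R) : a != 0 -> b != 0 ->
  X * a = Y / b * c -> X = Y / (b * a) * c.
Proof. by move=> a0 b0 e; apply: (mulIf a0); rewrite e; field; rewrite b0 a0. Qed.

End Final.

Local Open Scope ring_scope.

Theorem corollary1p4 (R : realType) :
  (exists eps C : R, [/\ 0 < eps, 0 < C &
     forall (n : nat) (dp dm : n.-tuple nat) (sigma : typefun),
       setting dp dm sigma ->
       (forall a : posnat * posnat, val a.2 != 1%N -> sigma a = 0%N) ->
       let g : R := (Delta dp dm sigma)%:R ^+ 4 / (sum_seq dp)%:R in
       let m : nat := num_arcs sigma in
       g < eps ->
       exists err : R, `|err| <= C * g /\
         (num_dirhyp dp dm sigma)%:R =
           ((sum_seq dp)`! * m`!)%:R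
           / ((\prod_(v < n) ((tnth dp v)`! * (tnth dm v)`!))
              * (\prod_(k <- kplus sigma) k`!)
              * (\prod_(a <- finsupp sigma | val a.2 == 1%N) (sigma a)`!))%N%:R
           * expR (F R dp (kplus sigma) - (Rd dp dm)%:R / m%:R + err)])
  /\
  (exists eps C : R, [/\ 0 < eps, 0 < C &
     forall (n : nat) (dp dm : n.-tuple nat) (sigma : typefun),
       setting dp dm sigma ->
       (forall a : posnat * posnat, val a.1 != 1%N -> sigma a = 0%N) ->
       let g : R := (Delta dp dm sigma)%:R ^+ 4 / (sum_seq dm)%:R in
       let m : nat := num_arcs sigma in
       g < eps ->
       exists err : R, `|err| <= C * g /\
         (num_dirhyp dp dm sigma)%:R =
           ((sum_seq dm)`! * m`!)%:R
           / ((\prod_(v < n) ((tnth dp v)`! * (tnth dm v)`!))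
              * (\prod_(k <- kminus sigma) k`!)
              * (\prod_(a <- finsupp sigma | val a.1 == 1%N) (sigma a)`!))%N%:R
           * expR (F R dm (kminus sigma) - (Rd dp dm)%:R / m%:R + err)]).
Proof.
have final n (dp dm d1 d2 : n.-tuple nat) (sigma : typefun) (ks : seq nat)
    (P : pred (posnat * posnat)) :
  #|labelled_dirhyp (tnth d1) (tnth d2) (fun e : 'I_(num_arcs sigma) => nth 0%N ks e)|
    = (num_dirhyp dp dm sigma * \prod_(a <- finsupp sigma) (sigma a)`!)%N ->
  size ks = num_arcs sigma ->
  sum_seq d1 = sum_seq ks -> sum_seq d2 = num_arcs sigma -> (0 < sum_seq d1)%N ->
  (max_seq d1 <= Delta dp dm sigma)%N -> (max_seq d2 <= Delta dp dm sigma)%N ->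
  (max_seq ks <= Delta dp dm sigma)%N ->
  (forall x, x \in ks -> 1 < x)%N ->
  {in finsupp sigma, forall a, P a} ->
  let g : R := (Delta dp dm sigma)%:R ^+ 4 / (sum_seq d1)%:R in
  g < 1 / 2000 ->
  exists err : R, `|err| <= 2003 * g /\
     (num_dirhyp dp dm sigma)%:R =
       ((sum_seq d1)`! * (num_arcs sigma)`!)%:R
       / ((\prod_(v < n) ((tnth d1 v)`! * (tnth d2 v)`!))
          * (\prod_(k <- ks) k`!)
          * (\prod_(a <- finsupp sigma | P a) (sigma a)`!))%N%:R
       * expR (F R d1 ks - (Rd d1 d2)%:R / (num_arcs sigma)%:R + err).
  move=> eL sz s1 s2 s0 m1 m2 m3 k2 PS g gs.
  have szb : size ks == num_arcs sigma by apply/eqP.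
  have [err [e1 e2]] := @count_seq_form R n _ d1 d2 (Tuple szb) _ s1 s2 s0 m1 m2 m3 k2 gs.
  exists err; split=> //.
  have eF : tnth (Tuple szb) = fun e : 'I_(num_arcs sigma) => nth 0%N ks e.
    by apply/funext => e; rewrite (tnth_nth 0%N).
  rewrite eF eL [(num_dirhyp _ _ _ * _)%N%:R]natrM in e2.
  have -> : (\prod_(a <- finsupp sigma | P a) (sigma a)`!
      = \prod_(a <- finsupp sigma) (sigma a)`!)%N.
    rewrite big_seq_cond [RHS]big_seq; apply: eq_bigl => a.
    by case: (boolP (a \in finsupp sigma)) => //= /PS ->.
  rewrite [(_ * \prod_(a <- finsupp sigma) _)%N%:R]natrM.
  have pf (I : Type) (r : seq I) (f : I -> nat) : (0 < \prod_(i <- r) (f i)`!)%N.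
    by apply: prodn_gt0 => i; exact: fact_gt0.
  apply: (divide_out _ _ e2); rewrite pnatr_eq0 -lt0n ?muln_gt0 ?pf ?andbT //.
  by apply: prodn_gt0 => v; rewrite muln_gt0 !fact_gt0.
have supp (sigma : typefun) a (P : pred (posnat * posnat)) :
    (forall a : posnat * posnat, ~~ P a -> sigma a = 0%N) -> a \in finsupp sigma -> P a.
  by move=> h; rewrite mem_finsupp; apply: contraR => /h /eqP.
have DD n (dp dm : n.-tuple nat) sigma :
    [/\ (max_seq dp <= Delta dp dm sigma)%N, (max_seq dm <= Delta dp dm sigma)%N,
        (max_seq (kplus sigma) <= Delta dp dm sigma)%N &
        (max_seq (kminus sigma) <= Delta dp dm sigma)%N].
  by rewrite /Delta !leq_max !leqnn !orbT.
(* 2000 comes from [count_labelled_dirhyp] and 3 from [F_approx]. *)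
split; exists (1 / 2000), 2003; (split; [lra|lra|]).
- move=> n dp dm sigma [sp sm p0 _ k3] hs g m gs.
  have [D1 D2 D3 D4] := DD n dp dm sigma.
  have S1 a : a \in finsupp sigma -> val a.2 == 1%N.
    by apply: (supp sigma a (fun a => val a.2 == 1%N)).
  have K2 a : a \in finsupp sigma -> (1 < val a.1)%N.
    by move=> aS; have := leq_trans k3 (kappa_le aS); rewrite (eqP (S1 a aS)) addn1 ltnS.
  apply: (final n dp dm dp dm sigma (kplus sigma) (fun a => val a.2 == 1%N)) => //.
  + rewrite -card_arrangements_klist card_arrangements; last first.
    * move=> e; have [|a aS ->] := @mem_klist sigma (nth (0%N, 0%N) (klist sigma) e).
        by rewrite mem_nth // size_klist.
      exact: ltnW (K2 a aS).
    * move=> e; have [|a aS ->] := @mem_klist sigma (nth (0%N, 0%N) (klist sigma) e).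
        by rewrite mem_nth // size_klist.
      exact/eqP/S1.
    congr #|pred_of_set (labelled_dirhyp _ _ _)|; apply/funext => e.
    by rewrite /kplus /unzip1 (nth_map (0%N, 0%N)) // size_klist.
  + by rewrite size_map size_klist.
  + by rewrite sp /sum_seq big_map sum_klist; apply: eq_bigr => a _; rewrite mulnC.
  + rewrite sm /num_arcs big_seq [RHS]big_seq; apply: eq_bigr => a aS.
    by rewrite (eqP (S1 a aS)) mul1n.
  + by move=> x /mapP[y /mem_klist[a aS ->] ->]; exact: K2.
- move=> n dp dm sigma [sp sm _ p0 k3] hs g m gs.
  have [D1 D2 D3 D4] := DD n dp dm sigma.
  have S1 a : a \in finsupp sigma -> val a.1 == 1%N.
    by apply: (supp sigma a (fun a => val a.1 == 1%N)).
  have K2 a : a \in finsupp sigma -> (1 < val a.2)%N.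
    by move=> aS; have := leq_trans k3 (kappa_le aS); rewrite (eqP (S1 a aS)) add1n ltnS.
  have -> : Rd dp dm = Rd dm dp by apply: eq_bigr => v _; rewrite mulnC.
  have -> : (\prod_(v < n) ((tnth dp v)`! * (tnth dm v)`!)
      = \prod_(v < n) ((tnth dm v)`! * (tnth dp v)`!))%N.
    by apply: eq_bigr => v _; rewrite mulnC.
  apply: (final n dp dm dm dp sigma (kminus sigma) (fun a => val a.1 == 1%N)) => //.
  + rewrite -card_arrangements_klist arrangements_reverse card_arrangements; last first.
    * move=> e; have [|a aS -> /=] := @mem_klist sigma (nth (0%N, 0%N) (klist sigma) e).
        by rewrite mem_nth // size_klist.
      exact: ltnW (K2 a aS).
    * move=> e; have [|a aS -> /=] := @mem_klist sigma (nth (0%N, 0%N) (klist sigma) e).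
        by rewrite mem_nth // size_klist.
      exact/eqP/S1.
    congr #|pred_of_set (labelled_dirhyp _ _ _)|; apply/funext => e.
    by rewrite /kminus /unzip2 (nth_map (0%N, 0%N)) // size_klist.
  + by rewrite size_map size_klist.
  + by rewrite sm /sum_seq big_map sum_klist; apply: eq_bigr => a _; rewrite mulnC.
  + rewrite sp /num_arcs big_seq [RHS]big_seq; apply: eq_bigr => a aS.
    by rewrite (eqP (S1 a aS)) mul1n.
  + by move=> x /mapP[y /mem_klist[a aS ->] ->]; exact: K2.
Qed.
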